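(* \textsc{Unweighted Stars NWS} is solvable in $\mathcal{O}(4^{c^2}\cdot (n+m) + n^2\cdot c)$ time.
   Context: An instance of \textsc{Unweighted Stars NWS} consists of a graph $G$ with $n$ vertices and $m$ edges, a collection $\mathcal{C}$ of $c$ subsets of $V(G)$ (communities), and an integer $\ell$; the question is whether there is a spanning subgraph $G'=(V(G),E')$ with $E'\subseteq E(G)$ and $|E'|\le\ell$ such that for every $C\in\mathcal{C}$ some vertex of $C$ is adjacent in $G'$ to all other vertices of $C$ (i.e. $G'[C]$ contains a spanning star). *)

(* Defs.v *)
From HB Require Import structures.
From mathcomp Require Import all_boot all_order all_algebra.

Set Implicit Arguments.
Unset Strict Implicit.
Unset Printing Implicit Defensive.

(** * Word RAM *)

(* Finitely many registers are mentioned by a program; [regs] and [mem] are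
   total functions only for convenience.  In the comments, r_i is register i
   and M[a] is memory cell a. *)
Inductive instr : Type :=
| IConst of nat & nat         (* IConst d v : r_d := v *)
| IAdd of nat & nat & nat     (* IAdd d a b : r_d := r_a + r_b *)
| ISub of nat & nat & nat     (* ISub d a b : r_d := max(0, r_a - r_b) *)
| IMul of nat & nat & nat     (* IMul d a b : r_d := r_a * r_b *)
| IRead of nat & nat          (* IRead d a  : r_d := M[r_a] *)
| IWrite of nat & nat         (* IWrite a b : M[r_a] := r_b *)
| IJz of nat & nat            (* IJz a p    : if r_a = 0, goto p *)
| IHalt of bool.              (* IHalt true accepts, IHalt false rejects *)

Definition program := seq instr.

Record config := Config { pc : nat; regs : nat -> nat; mem : nat -> nat }.

Definition upd (f : nat -> nat) (i v : nat) : nat -> nat :=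
  fun j => if j == i then v else f j.

(* Running past the end of the program rejects. *)
Definition fetch (P : program) (s : config) : instr :=
  nth (IHalt false) P (pc s).

(* A halted configuration is a fixed point of [step]. *)
Definition step (P : program) (s : config) : config :=
  let: Config p r m := s in
  match fetch P s with
  | IConst d v => Config p.+1 (upd r d v) m
  | IAdd d a b => Config p.+1 (upd r d (r a + r b)) m
  | ISub d a b => Config p.+1 (upd r d (r a - r b)) m
  | IMul d a b => Config p.+1 (upd r d (r a * r b)) m
  | IRead d a => Config p.+1 (upd r d (m (r a))) m
  | IWrite a b => Config p.+1 r (upd m (r a) (r b))
  | IJz a q => Config (if r a == 0 then q else p.+1) r m
  | IHalt _ => s
  end.

Definition verdict (P : program) (s : config) : option bool :=
  if fetch P s is IHalt b then Some b else None.

Definition init (x : seq nat) : config :=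
  Config 0 (fun _ => 0) (fun a => nth 0 x a).

Definition run (P : program) (x : seq nat) (t : nat) : config :=
  iter t (step P) (init x).

Definition fits (W : nat) (s : config) : Prop :=
  forall i, regs s i <= W /\ mem s i <= W.

Definition magnitude (x : seq nat) : nat := size x + \max_(v <- x) v.

(* The decision problem [yes], with inputs presented through the relation
   [enc], is solvable in O(f) time.  Each instruction costs one step, and every
   word ever held by the machine is at most magnitude x ^ k for a fixed k, i.e.,
   words have O(log (magnitude x)) bits, so that unit cost is legitimate.
   The [maxn 1] only matters on the degenerate inputs where f vanishes. *)
Definition solvable_in_time (I : Type) (enc : I -> seq nat -> Prop)
    (yes : I -> Prop) (f : I -> nat) : Prop :=
  exists (P : program) (k K : nat), forall (i : I) (x : seq nat), enc i x ->
    exists (t : nat) (b : bool),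
      [/\ t <= K * maxn 1 (f i),
          verdict P (run P x t) = Some b,
          b <-> yes i
        & forall u, u <= t -> fits (magnitude x ^ k) (run P x u)].

(** * Unweighted Stars NWS *)

Record graph (n : nat) := Graph {
  edges : {set {set 'I_n}};
  edgesP : forall e, e \in edges -> #|e| = 2
}.

Definition adj n (G : graph n) (u v : 'I_n) : bool := [set u; v] \in edges G.

Definition has_spanning_star n (G : graph n) (C : {set 'I_n}) : Prop :=
  exists2 v, v \in C & forall w, w \in C -> w != v -> adj G v w.

Record instance := Instance {
  num_vertices : nat;
  host : graph num_vertices;
  communities : seq {set 'I_num_vertices};
  budget : int
}.

Definition num_edges (I : instance) : nat := #|edges (host I)|.

Definition num_communities (I : instance) : nat := size (communities I).

Definition unweighted_stars_nws (I : instance) : Prop :=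
  exists G' : graph (num_vertices I),
    [/\ edges G' \subset edges (host I),
        (#|edges G'|%:Z <= budget I)%R
      & forall C, C \in communities I -> has_spanning_star G' C].

(* An input is the list of words n, m, c, sign and absolute value of the
   budget, then the two endpoints of each edge, then each community as its size
   followed by its members.  The edges, the endpoints of an edge and the members
   of a community may come in any order, each being listed exactly once. *)
Definition encodes (I : instance) (x : seq nat) : Prop :=
  exists (es : seq ('I_(num_vertices I) * 'I_(num_vertices I)))
         (ls : seq (seq 'I_(num_vertices I))),
    [/\ perm_eq [seq [set e.1; e.2] | e <- es] (enum (edges (host I))),
        all2 (fun l (C : {set 'I_(num_vertices I)}) => perm_eq l (enum C))
             ls (communities I)
      & x = [:: num_vertices I; num_edges I; num_communities I;
                nat_of_bool (budget I < 0)%R; `|budget I|%N]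
            ++ flatten [seq [:: val e.1; val e.2] | e <- es]
            ++ flatten [seq size l :: [seq val v | v <- l] | l <- ls]].

(* Main.v *)
Require Import Defs.
From HB Require Import structures.
From mathcomp Require Import all_boot all_order all_algebra.
From mathcomp Require Import perm zify.

Set Implicit Arguments.
Unset Strict Implicit.
Unset Printing Implicit Defensive.

(** A solution is determined by a centre [phi i] for every community [i]; it
    costs the number of edges of the host that lie inside some community and
    contain its centre.  Call two vertices twins if they belong to the same
    communities and are possible centres of the same communities.  If [u] and
    [v] are twins, moving every centre from [v] to [u] does not increase the
    cost: the transposition of [u] and [v] maps gained edges injectively to lost
    ones.  So it is enough to try centres among one representative of each of
    the at most [3 ^ c] twin classes, that is at most [3 ^ (c ^ 2)] assignments,
    each of which is evaluated in time [O(c (n + m))]; moreover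
    [c * 3 ^ (c ^ 2) <= 4 ^ (c ^ 2)].  The representatives are found by comparing
    columns of a [c] by [n] table, in time [O(n ^ 2 c)].

    Running times are proved for a structured language with two-dimensional
    arrays, whose compilation to the word RAM costs only a constant factor. *)

(** * A structured language *)

(** Three values per community describe a twin class because a possible centre is always a member:
    outside, member only, possible centre. The two halves of the twin relation serve different ends:
    equal centre status keeps the modified assignment valid, equal membership shows that the edge
    removed by the transposition is no longer paid for. Only costs are compared, never edge sets, so
    vertices can be exchanged one after the other until all centres are representatives.

    An evaluation in time O(c (n + m)) leaves no room for searching the member lists: membership of
    an endpoint has to be a single access, which is why the communities are expanded into a table.
    Memory past the input is zero, so the table needs no initialisation. *)

Inductive expr : Type :=
| Var of nat
| Cst of nat
| Plus of expr & expr
| Minus of expr & expr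
| Inp of expr
| Arr of nat & expr & expr.

Inductive cmd : Type :=
| Skip
| Asg of nat & expr
| Sto of nat & expr & expr & expr
| Seq of cmd & cmd
| If of expr & cmd & cmd
| Whl of expr & cmd.

Record state := State { var : nat -> nat; arr : nat -> nat -> nat -> nat }.

Definition set_var (s : state) (d v : nat) : state := State (upd (var s) d v) (arr s).

Definition set_arr (s : state) (k i j v : nat) : state :=
  State (var s)
        (fun k' i' j' => if [&& k' == k, i' == i & j' == j] then v else arr s k' i' j').

Section Semantics.

Variables (inp : nat -> nat) (B n c V : nat).

Fixpoint eval (s : state) (e : expr) : nat :=
  match e with
  | Var v => var s v
  | Cst k => k
  | Plus a b => eval s a + eval s b
  | Minus a b => eval s a - eval s b
  | Inp a => inp (eval s a)
  | Arr k a b => arr s k (eval s a) (eval s b)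
  end.

(** What compiled code needs in order to respect the word bound and the memory layout: constants and
    sums are at most [V], input reads lie below [B], array indices lie in the [c] by [n] rectangle.
    Values already stored need no test, since the configuration holding them fits, and truncated
    differences only shrink. *)
Fixpoint safe (s : state) (e : expr) : bool :=
  match e with
  | Var _ => true
  | Cst k => k <= V
  | Plus a b => [&& safe s a, safe s b & eval s a + eval s b <= V]
  | Minus a b => safe s a && safe s b
  | Inp a => safe s a && (eval s a < B)
  | Arr k a b => [&& k < 4, safe s a, safe s b, eval s a < c & eval s b < n]
  end.

(** The number is the time. Evaluating an expression is covered by a single unit because its
    compiled length depends on the program alone. *)
Inductive exec : cmd -> state -> nat -> state -> Prop :=
| ESkip s : exec Skip s 0 s
| EAsg s d e : safe s e -> exec (Asg d e) s 1 (set_var s d (eval s e))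
| ESto s k a b e : safe s (Arr k a b) -> safe s e ->
    exec (Sto k a b e) s 1 (set_arr s k (eval s a) (eval s b) (eval s e))
| ESeq s1 s2 s3 p q t u : exec p s1 t s2 -> exec q s2 u s3 ->
    exec (Seq p q) s1 (t + u) s3
| EIf s s' e p q t : safe s e -> exec (if eval s e == 0 then q else p) s t s' ->
    exec (If e p q) s t.+1 s'
| EWhl0 s e p : safe s e -> eval s e = 0 -> exec (Whl e p) s 1 s
| EWhl1 s1 s2 s3 e p t u : safe s1 e -> eval s1 e <> 0 -> exec p s1 t s2 ->
    exec (Whl e p) s2 u s3 -> exec (Whl e p) s1 (t + u).+1 s3.

End Semantics.

(** * Compilation to the word RAM *)

(* Variable v lives in register 2v; odd registers are scratch, except that
   registers 1 and 3 permanently hold the base address B and the row length n.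
   Cell (i, j) of array k lives at address B + 4 (i n + j) + k. *)
Notation tmp t := (t.*2.+1).

Definition addr_code (k t : nat) : seq instr :=
  [:: IMul (tmp t) (tmp t) 3; IAdd (tmp t) (tmp t) (tmp t.+1); IConst (tmp t.+1) 4;
      IMul (tmp t) (tmp t) (tmp t.+1); IConst (tmp t.+1) k; IAdd (tmp t) (tmp t) (tmp t.+1);
      IAdd (tmp t) (tmp t) 1].

(** The value ends up in [tmp t]; temporaries of smaller depth hold pending operands and stay
    untouched. Calls start at depth 2 because [tmp 0] and [tmp 1] are the two reserved registers. *)
Fixpoint cexp (e : expr) (t : nat) : seq instr :=
  match e with
  | Var v => [:: IConst (tmp t) 0; IAdd (tmp t) (tmp t) v.*2]
  | Cst k => [:: IConst (tmp t) k]
  | Plus a b => cexp a t ++ cexp b t.+1 ++ [:: IAdd (tmp t) (tmp t) (tmp t.+1)]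
  | Minus a b => cexp a t ++ cexp b t.+1 ++ [:: ISub (tmp t) (tmp t) (tmp t.+1)]
  | Inp a => cexp a t ++ [:: IRead (tmp t) (tmp t)]
  | Arr k a b =>
      cexp a t ++ cexp b t.+1 ++ addr_code k t ++ [:: IRead (tmp t) (tmp t)]
  end.

Fixpoint csize (c : cmd) : nat :=
  match c with
  | Skip => 0
  | Asg d e => size (cexp e 2) + 2
  | Sto k a b e => size (cexp e 2) + (size (cexp a 3) + (size (cexp b 4) + 8))
  | Seq p q => csize p + csize q
  | If e p q => size (cexp e 2) + (csize p + csize q).+3
  | Whl e p => size (cexp e 2) + (csize p).+3
  end.

(** Jumps are absolute, so the load address [p] is a parameter; [csize] does not depend on it and
    gives the targets. Clearing register 5 before [IJz 5] makes an unconditional jump, and adding a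
    zero makes a move. *)
Fixpoint compile (c : cmd) (p : nat) : seq instr :=
  match c with
  | Skip => [::]
  | Asg d e => cexp e 2 ++ [:: IConst 7 0; IAdd d.*2 5 7]
  | Sto k a b e =>
      cexp e 2 ++ cexp a 3 ++ cexp b 4 ++ addr_code k 3 ++ [:: IWrite 7 5]
  | Seq c1 c2 => compile c1 p ++ compile c2 (p + csize c1)
  | If e c1 c2 =>
      let l := (p + size (cexp e 2)).+1 in
      cexp e 2 ++ IJz 5 (l + csize c1).+2 :: compile c1 l
        ++ IConst 5 0 :: IJz 5 (l + csize c1 + csize c2).+2
        :: compile c2 (l + csize c1).+2
  | Whl e c1 =>
      let l := (p + size (cexp e 2)).+1 in
      cexp e 2 ++ IJz 5 (l + csize c1).+2 :: compile c1 l
        ++ [:: IConst 5 0; IJz 5 p]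
  end.

Lemma size_compile c p : size (compile c p) = csize c.
Proof.
elim: c p => //=.
- by move=> d e p; rewrite size_cat.
- by move=> k a b e p; rewrite !size_cat.
- by move=> c1 IH1 c2 IH2 p; rewrite size_cat IH1 IH2.
- by move=> e c1 IH1 c2 IH2 p; rewrite size_cat /= size_cat /= IH1 IH2 !addnS.
- by move=> e c1 IH1 p; rewrite size_cat /= size_cat /= IH1 addn2.
Qed.

(** * Machine runs whose words stay bounded *)

Section Machine.

Variables (P : program) (W : nat).

(** Bounding every intermediate configuration, and not only the last, lets the word bound compose
    along a run. *)
Definition reach (s : config) (t : nat) (s' : config) : Prop :=
  iter t (step P) s = s' /\ forall u, u <= t -> fits W (iter u (step P) s).

Lemma reach0 s : fits W s -> reach s 0 s.
Proof. by move=> hs; split=> // u; rewrite leqn0 => /eqP->. Qed.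

Lemma reach_trans s t s' t' s'' :
  reach s t s' -> reach s' t' s'' -> reach s (t + t') s''.
Proof.
move=> [h1 f1] [h2 f2]; split; first by rewrite addnC iterD h1.
move=> u hu; case: (leqP u t) => htu; first exact: f1.
have -> : u = (u - t) + t by lia.
by rewrite iterD h1; apply: f2; lia.
Qed.

Lemma reach_step s s' : fits W s -> step P s = s' -> fits W s' -> reach s 1 s'.
Proof. by move=> h <- h'; split=> // [] [|[|u]]. Qed.

Lemma reach_fits s t s' : reach s t s' -> fits W s'.
Proof. by move=> [<- h]; exact: h. Qed.

Definition code_at (p : nat) (cs : seq instr) : Prop :=
  forall i, i < size cs -> nth (IHalt false) P (p + i) = nth (IHalt false) cs i.

Lemma code_at_cat p a b :
  code_at p (a ++ b) -> code_at p a /\ code_at (p + size a) b.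
Proof.
move=> h; split=> i hi.
  by rewrite h ?nth_cat ?hi // size_cat ltn_addr.
rewrite -addnA h ?size_cat ?ltn_add2l // nth_cat.
by rewrite ltnNge leq_addr /= addKn.
Qed.

Lemma code_at_cons p i b :
  code_at p (i :: b) -> nth (IHalt false) P p = i /\ code_at p.+1 b.
Proof.
move=> h; split; first by have := h 0 isT; rewrite addn0.
by move=> j hj; rewrite addSnnS h.
Qed.

Lemma fits_upd_reg p q r m d v :
  fits W (Config p r m) -> v <= W -> fits W (Config q (upd r d v) m).
Proof.
move=> h hv i; have [/= h1 h2] := h i.
by rewrite /upd; split=> //; case: eqP.
Qed.

Lemma fits_upd_mem p q r m d v :
  fits W (Config p r m) -> v <= W -> fits W (Config q r (upd m d v)).
Proof.
move=> h hv i; have [/= h1 h2] := h i.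
by rewrite /upd; split=> //; case: eqP.
Qed.

Lemma fits_reg p r m i : fits W (Config p r m) -> r i <= W.
Proof. by move=> h; case: (h i). Qed.

Lemma fits_mem p r m i : fits W (Config p r m) -> m i <= W.
Proof. by move=> h; case: (h i). Qed.

Lemma reach_const p r m d v : nth (IHalt false) P p = IConst d v ->
  fits W (Config p r m) -> v <= W ->
  reach (Config p r m) 1 (Config p.+1 (upd r d v) m).
Proof.
move=> hp hf hv; apply: reach_step => //; first by rewrite /= /fetch /= hp.
exact: fits_upd_reg hf hv.
Qed.

Lemma reach_add p r m d a b : nth (IHalt false) P p = IAdd d a b ->
  fits W (Config p r m) -> r a + r b <= W ->
  reach (Config p r m) 1 (Config p.+1 (upd r d (r a + r b)) m).
Proof.
move=> hp hf hv; apply: reach_step => //; first by rewrite /= /fetch /= hp.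
exact: fits_upd_reg hf hv.
Qed.

Lemma reach_sub p r m d a b : nth (IHalt false) P p = ISub d a b ->
  fits W (Config p r m) ->
  reach (Config p r m) 1 (Config p.+1 (upd r d (r a - r b)) m).
Proof.
move=> hp hf; apply: reach_step => //; first by rewrite /= /fetch /= hp.
by apply: (fits_upd_reg _ _ hf); have := fits_reg a hf; lia.
Qed.

Lemma reach_mul p r m d a b : nth (IHalt false) P p = IMul d a b ->
  fits W (Config p r m) -> r a * r b <= W ->
  reach (Config p r m) 1 (Config p.+1 (upd r d (r a * r b)) m).
Proof.
move=> hp hf hv; apply: reach_step => //; first by rewrite /= /fetch /= hp.
exact: fits_upd_reg hf hv.
Qed.

Lemma reach_read p r m d a : nth (IHalt false) P p = IRead d a ->
  fits W (Config p r m) ->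
  reach (Config p r m) 1 (Config p.+1 (upd r d (m (r a))) m).
Proof.
move=> hp hf; apply: reach_step => //; first by rewrite /= /fetch /= hp.
exact: (fits_upd_reg _ _ hf (fits_mem (r a) hf)).
Qed.

Lemma reach_write p r m a b : nth (IHalt false) P p = IWrite a b ->
  fits W (Config p r m) ->
  reach (Config p r m) 1 (Config p.+1 r (upd m (r a) (r b))).
Proof.
move=> hp hf; apply: reach_step => //; first by rewrite /= /fetch /= hp.
exact: (fits_upd_mem _ _ hf (fits_reg b hf)).
Qed.

Lemma reach_jz p r m a q : nth (IHalt false) P p = IJz a q ->
  fits W (Config p r m) ->
  reach (Config p r m) 1 (Config (if r a == 0 then q else p.+1) r m).
Proof. by move=> hp hf; apply: reach_step; rewrite //= /fetch /= hp. Qed.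

(** * Correctness of the compiler *)

Variables (inp : nat -> nat) (B n c V : nat).
Hypothesis leVW : V <= W.
Hypothesis le4W : 4 <= W.
Hypothesis leBW : B + 4 * (c * n) <= W.

(** Nothing is said about the scratch registers, so the relation survives the evaluation of any
    expression. *)
Record sim (s : state) (r m : nat -> nat) : Prop := Sim {
  sim_var : forall v, r v.*2 = var s v;
  sim_base : r 1 = B;
  sim_len : r 3 = n;
  sim_inp : forall a, a < B -> m a = inp a;
  sim_arr : forall k i j, k < 4 -> i < c -> j < n ->
    m (B + 4 * (i * n + j) + k) = arr s k i j
}.

(** The frame of an evaluation at depth [t], for [t] at least 2: the variables, the two reserved
    registers and the operands pending at smaller depths. *)
Definition below (t : nat) (r r' : nat -> nat) : Prop :=
  forall i, ~~ odd i || (i < tmp t) -> r' i = r i.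

Lemma sim_below t s r r' m : 2 <= t -> below t r r' -> sim s r m -> sim s r' m.
Proof.
move=> ht hb [h1 h2 h3 h4 h5]; split=> // [v||].
- by rewrite hb ?h1 // odd_double.
- by rewrite hb ?h2 //; lia.
- by rewrite hb ?h3 //; lia.
Qed.

Lemma below_upd t r r' d v : tmp t <= d -> odd d -> below t r r' ->
  below t r (upd r' d v).
Proof.
move=> h1 h2 hb i hi; rewrite /upd; case: eqP => [e|_]; last exact: hb.
by move: hi; rewrite e h2 /=; lia.
Qed.

Lemma below_trans t t' r r' r'' : t <= t' ->
  below t r r' -> below t' r' r'' -> below t r r''.
Proof. by move=> h h1 h2 i hi; rewrite h2 ?h1 //; move: hi; lia. Qed.

Lemma upd_same f i v : upd f i v i = v.
Proof. by rewrite /upd eqxx. Qed.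

Lemma upd_other f i v j : j != i -> upd f i v j = f j.
Proof. by rewrite /upd => /negbTE->. Qed.

Lemma cell_ltn i j : i < c -> j < n -> (i * n + j).+1 <= c * n.
Proof.
move=> hi hj; apply: leq_trans (_ : i.+1 * n <= _); last by rewrite leq_pmul2r; lia.
by rewrite mulSn; lia.
Qed.

Lemma addr_code_correct k t p r m i j : 2 <= t -> k < 4 -> i < c -> j < n ->
  r 1 = B -> r 3 = n -> r (tmp t) = i -> r (tmp t.+1) = j ->
  code_at p (addr_code k t) -> fits W (Config p r m) ->
  exists r', [/\ reach (Config p r m) 7 (Config (p + 7) r' m),
    r' (tmp t) = B + 4 * (i * n + j) + k & below t r r'].
Proof.
move=> ht hk hi hj hB hn hri hrj.
move=> /code_at_cons [c1] /code_at_cons [c2] /code_at_cons [c3] /code_at_cons [c4].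
move=> /code_at_cons [c5] /code_at_cons [c6] /code_at_cons [c7 _] hf.
have hcell := cell_ltn hi hj.
(* Writing the intermediate register files with plain values reduces each overflow check to linear
   arithmetic from [hcell]. *)
pose r1 := upd r (tmp t) (i * n).
pose r2 := upd r1 (tmp t) (i * n + j).
pose r3 := upd r2 (tmp t.+1) 4.
pose r4 := upd r3 (tmp t) ((i * n + j) * 4).
pose r5 := upd r4 (tmp t.+1) k.
pose r6 := upd r5 (tmp t) ((i * n + j) * 4 + k).
pose r7 := upd r6 (tmp t) ((i * n + j) * 4 + k + B).
have ne1 : (tmp t.+1 == tmp t) = false by lia.
have ne2 : (tmp t == tmp t.+1) = false by lia.
have ne3 : (1 == tmp t) = false by lia.
have ne4 : (1 == tmp t.+1) = false by lia.
have s1 : reach (Config p r m) 1 (Config p.+1 r1 m).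
  have e : i * n = r (tmp t) * r 3 by rewrite hri hn.
  by rewrite /r1 e; apply: reach_mul hf _ => //; rewrite -e; lia.
have s2 : reach (Config p.+1 r1 m) 1 (Config p.+2 r2 m).
  have e : i * n + j = r1 (tmp t) + r1 (tmp t.+1) by rewrite /r1 /upd eqxx ne1 hrj.
  by rewrite /r2 e; apply: reach_add (reach_fits s1) _ => //; rewrite -e; lia.
have s3 : reach (Config p.+2 r2 m) 1 (Config p.+3 r3 m).
  exact: reach_const (reach_fits s2) _.
have s4 : reach (Config p.+3 r3 m) 1 (Config p.+4 r4 m).
  have e : (i * n + j) * 4 = r3 (tmp t) * r3 (tmp t.+1).
    by rewrite /r3 /r2 /upd !eqxx ne2.
  by rewrite /r4 e; apply: reach_mul (reach_fits s3) _ => //; rewrite -e; lia.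
have s5 : reach (Config p.+4 r4 m) 1 (Config p.+4.+1 r5 m).
  by apply: reach_const (reach_fits s4) _ => //; lia.
have s6 : reach (Config p.+4.+1 r5 m) 1 (Config p.+4.+2 r6 m).
  have e : (i * n + j) * 4 + k = r5 (tmp t) + r5 (tmp t.+1).
    by rewrite /r5 /r4 /upd !eqxx ne2.
  by rewrite /r6 e; apply: reach_add (reach_fits s5) _ => //; rewrite -e; lia.
have s7 : reach (Config p.+4.+2 r6 m) 1 (Config p.+4.+3 r7 m).
  have e : (i * n + j) * 4 + k + B = r6 (tmp t) + r6 1.
    by rewrite /r6 /r5 /r4 /r3 /r2 /r1 /upd !eqxx ne3 ne4 hB.
  by rewrite /r7 e; apply: reach_add (reach_fits s6) _ => //; rewrite -e; lia.
exists r7; split.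
- rewrite addnC; apply: (reach_trans s1); apply: (reach_trans s2).
  apply: (reach_trans s3); apply: (reach_trans s4); apply: (reach_trans s5).
  exact: (reach_trans s6).
- by rewrite /r7 upd_same; lia.
- by do 7! (apply: below_upd; [lia | rewrite /= odd_double //= |]).
Qed.

Lemma cexp_correct e s t p r m : 2 <= t -> sim s r m -> safe inp B n c V s e ->
  code_at p (cexp e t) -> fits W (Config p r m) ->
  exists r', [/\ reach (Config p r m) (size (cexp e t))
                       (Config (p + size (cexp e t)) r' m),
    r' (tmp t) = eval inp s e & below t r r'].
Proof.
elim: e t p r => [v|k|a IHa b IHb|a IHa b IHb|a IHa|k a IHa b IHb] t p r ht hs.
- move=> _ /= /code_at_cons [c1 /code_at_cons [c2 _]] hf.
  have s1 := reach_const c1 hf (leq0n W).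
  have e1 : upd r (tmp t) 0 (tmp t) + upd r (tmp t) 0 v.*2 = var s v.
    by rewrite upd_same upd_other ?(sim_var hs) //; lia.
  have h2 : var s v <= W by rewrite -(sim_var hs); apply: fits_reg hf.
  have := reach_add c2 (reach_fits s1); rewrite e1 => /(_ h2) s2.
  exists (upd (upd r (tmp t) 0) (tmp t) (var s v)); split.
  + by rewrite addn2; apply: reach_trans s1 s2.
  + by rewrite upd_same.
  + by do 2! (apply: below_upd; rewrite //= ?odd_double //).
- move=> /= hk /code_at_cons [c1 _] hf.
  exists (upd r (tmp t) k); split.
  + by rewrite addn1; apply: reach_const => //; lia.
  + by rewrite upd_same.
  + by apply: below_upd; rewrite //= ?odd_double.
- move=> /= /and3P [ha hb hv] /code_at_cat [ca /code_at_cat [cb /code_at_cons [c1 _]]] hf.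
  have [ra [s1 ea ba]] := IHa _ _ _ ht hs ha ca hf.
  have hsa := sim_below ht ba hs.
  have [//|rb [s2 eb bb]] := IHb t.+1 _ _ _ hsa hb cb (reach_fits s1); first lia.
  have ea' : rb (tmp t) = eval inp s a by rewrite bb //; lia.
  have := reach_add c1 (reach_fits s2); rewrite ea' eb => /(_ (leq_trans hv leVW)) s3.
  exists (upd rb (tmp t) (eval inp s a + eval inp s b)); split.
  + rewrite !size_cat [size [:: _]]/=.
    have -> : p + (size (cexp a t) + (size (cexp b t.+1) + 1)) =
      (p + size (cexp a t) + size (cexp b t.+1)).+1 by lia.
    exact: reach_trans s1 (reach_trans s2 s3).
  + by rewrite upd_same.
  + by apply: below_upd; rewrite //= ?odd_double //; apply: below_trans ba bb.
- move=> /= /andP [ha hb] /code_at_cat [ca /code_at_cat [cb /code_at_cons [c1 _]]] hf.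
  have [ra [s1 ea ba]] := IHa _ _ _ ht hs ha ca hf.
  have hsa := sim_below ht ba hs.
  have [//|rb [s2 eb bb]] := IHb t.+1 _ _ _ hsa hb cb (reach_fits s1); first lia.
  have ea' : rb (tmp t) = eval inp s a by rewrite bb //; lia.
  have := reach_sub c1 (reach_fits s2); rewrite ea' eb => s3.
  exists (upd rb (tmp t) (eval inp s a - eval inp s b)); split.
  + rewrite !size_cat [size [:: _]]/=.
    have -> : p + (size (cexp a t) + (size (cexp b t.+1) + 1)) =
      (p + size (cexp a t) + size (cexp b t.+1)).+1 by lia.
    exact: reach_trans s1 (reach_trans s2 s3).
  + by rewrite upd_same.
  + by apply: below_upd; rewrite //= ?odd_double //; apply: below_trans ba bb.
- move=> /= /andP [ha hB] /code_at_cat [ca /code_at_cons [c1 _]] hf.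
  have [ra [s1 ea ba]] := IHa _ _ _ ht hs ha ca hf.
  have := reach_read c1 (reach_fits s1); rewrite ea (sim_inp hs hB) => s2.
  exists (upd ra (tmp t) (inp (eval inp s a))); split.
  + by rewrite size_cat [size [:: _]]/= addnA [_ + _ + 1]addn1; apply: reach_trans s1 s2.
  + by rewrite upd_same.
  + by apply: below_upd; rewrite //= ?odd_double.
- move=> /and5P [hk ha hb hi hj]; rewrite [cexp _ _](erefl
    (cexp a t ++ cexp b t.+1 ++ addr_code k t ++ [:: IRead (tmp t) (tmp t)])).
  move=> /code_at_cat [ca /code_at_cat [cb /code_at_cat [cd /code_at_cons [c1 _]]]] hf.
  have [ra [s1 ea ba]] := IHa _ _ _ ht hs ha ca hf.
  have hsa := sim_below ht ba hs.
  have [//|rb [s2 eb bb]] := IHb t.+1 _ _ _ hsa hb cb (reach_fits s1); first lia.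
  have ea' : rb (tmp t) = eval inp s a by rewrite bb //; lia.
  have hsb : sim s rb m by apply: sim_below bb hsa; lia.
  have [rd [s3 ed bd]] := addr_code_correct ht hk hi hj (sim_base hsb)
    (sim_len hsb) ea' eb cd (reach_fits s2).
  have := reach_read c1 (reach_fits s3).
  rewrite ed (sim_arr hs hk hi hj) => s4.
  exists (upd rd (tmp t) (arr s k (eval inp s a) (eval inp s b))); split.
  + rewrite !size_cat [size (addr_code _ _)]/= [size [:: _]]/=.
    have -> : p + (size (cexp a t) + (size (cexp b t.+1) + (7 + 1))) =
      (p + size (cexp a t) + size (cexp b t.+1) + 7).+1 by lia.
    exact: reach_trans s1 (reach_trans s2 (reach_trans s3 s4)).
  + by rewrite upd_same.
  + apply: below_upd; rewrite //= ?odd_double //.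
    by apply: below_trans bd => //; apply: below_trans ba bb.
Qed.

Lemma sim_scratch s r m d v : odd d -> 4 < d -> sim s r m -> sim s (upd r d v) m.
Proof.
by move=> h1 h2; apply: sim_below (_ : below 2 _ _) => //; apply: below_upd.
Qed.

Lemma cell_inj i j i' j' : j < n -> j' < n ->
  i * n + j = i' * n + j' -> i = i' /\ j = j'.
Proof.
move=> h h' e; have n0 : 0 < n by lia.
have := congr1 (divn^~ n) e; rewrite !divnMDl // !divn_small // !addn0 => ei.
by split=> //; move: e; rewrite ei; lia.
Qed.

(** One unit of source time pays for one traversal of the instructions belonging to a construct
    itself, at most its [csize]. A loop pays for its guard and its jumps with the unit charged at
    each round, so the factor does not grow with the number of rounds. *)
Lemma compile_correct cm s t s' : exec inp B n c V cm s t s' ->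
  forall p r m, sim s r m -> code_at p (compile cm p) -> fits W (Config p r m) ->
  exists t' r' m', [/\ t' <= csize cm * t,
    reach (Config p r m) t' (Config (p + csize cm) r' m') & sim s' r' m'].
Proof.
elim=> {cm s t s'}.
- move=> s p r m hs _ hf; exists 0, r, m; split=> //.
  by rewrite addn0; exact: reach0.
- move=> s d e he p r m hs /= /code_at_cat [ce /code_at_cons [c1 /code_at_cons [c2 _]]] hf.
  have [r1 [s1 e1 b1]] := cexp_correct (leqnn 2) hs he ce hf.
  have s2 := reach_const c1 (reach_fits s1) (leq0n W).
  have e2 : upd r1 7 0 5 + upd r1 7 0 7 = eval inp s e.
    by rewrite upd_same upd_other // addn0.
  have h2 : eval inp s e <= W by rewrite -e1; apply: fits_reg (reach_fits s1).
  have := reach_add c2 (reach_fits s2); rewrite e2 => /(_ h2) s3.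
  have hs2 : sim s (upd r1 7 0) m by apply: sim_scratch => //; apply: sim_below b1 hs.
  exists (size (cexp e 2) + 2), (upd (upd r1 7 0) d.*2 (eval inp s e)), m.
  rewrite muln1; split=> //.
    by rewrite addnA [p + _ + 2]addn2; exact: reach_trans s1 (reach_trans s2 s3).
  case: hs2 => h1 h3 h4 h5 h6; split=> //.
  + move=> v; rewrite {1}/upd /= /upd.
    have -> : (v.*2 == d.*2) = (v == d) by lia.
    by case: eqP => // _; rewrite -h1.
  + by rewrite upd_other //; lia.
  + by rewrite upd_other //; lia.
- move=> s k a b e /and5P [hk ha hb hi hj] he p r m hs; rewrite [compile _ _](erefl
    (cexp e 2 ++ cexp a 3 ++ cexp b 4 ++ addr_code k 3 ++ [:: IWrite 7 5])).
  move=> /code_at_cat [ce] /code_at_cat [ca] /code_at_cat [cb] /code_at_cat [cd].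
  move=> /code_at_cons [cw _] hf.
  have [r1 [s1 e1 b1]] := cexp_correct (leqnn 2) hs he ce hf.
  have hs1 := sim_below (leqnn 2) b1 hs.
  have [//|r2 [s2 e2 b2]] := cexp_correct _ hs1 ha ca (reach_fits s1).
  have hs2 : sim s r2 m by apply: sim_below b2 hs1.
  have [//|r3 [s3 e3 b3]] := cexp_correct _ hs2 hb cb (reach_fits s2).
  have hs3 : sim s r3 m by apply: sim_below b3 hs2.
  have e2' : r3 7 = eval inp s a by rewrite b3.
  have [//|r4 [s4 e4 b4]] := addr_code_correct _ hk hi hj (sim_base hs3)
    (sim_len hs3) e2' e3 cd (reach_fits s3).
  have hs4 : sim s r4 m by apply: sim_below b4 hs3.
  have e5 : r4 5 = eval inp s e by rewrite b4 // b3 // b2.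
  have := reach_write cw (reach_fits s4); rewrite e5 [r4 7]e4 => s5.
  eexists _, r4, _; rewrite muln1; split; first exact: leqnn.
  + have -> : p + (size (cexp e 2) + (size (cexp a 3) + (size (cexp b 4) + 8))) =
      (p + size (cexp e 2) + size (cexp a 3) + size (cexp b 4) + 7).+1 by lia.
    apply: (reach_trans s1); apply: (reach_trans s2); apply: (reach_trans s3).
    exact: reach_trans s4 s5.
  + case: hs4 => h1 h3 h4 h5 h6; split=> //.
    * by move=> x hx; rewrite upd_other ?h5 //; lia.
    * move=> k' i' j' hk' hi' hj' /=; rewrite /upd -h6 //.
      case: and3P => [[/eqP-> /eqP-> /eqP->]|hne]; first by rewrite eqxx.
      case: eqP => // ee; exfalso; apply: hne.
      (* Both array numbers are below 4: relative to [B], the residue of the address modulo 4 gives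
         the array and the quotient gives the cell. *)
      have ek : k' = k by lia.
      have ecell : i' * n + j' = eval inp s a * n + eval inp s b by lia.
      by have [-> ->] := cell_inj hj' hj ecell; rewrite ek.
- move=> s1 s2 s3 c1 c2 t u _ IH1 _ IH2 p r m hs /= /code_at_cat [].
  rewrite size_compile => cd1 cd2 hf.
  have [t1 [r1 [m1 [ht1 st1 hs1]]]] := IH1 _ _ _ hs cd1 hf.
  have [t2 [r2 [m2 [ht2 st2 hs2]]]] := IH2 _ _ _ hs1 cd2 (reach_fits st1).
  exists (t1 + t2), r2, m2; split=> //; first by nia.
  by rewrite addnA; apply: reach_trans st1 st2.
- move=> s s' e c1 c2 t he _ IH p r m hs /= /code_at_cat [ce].
  move=> /code_at_cons [j1] /code_at_cat [cd1]; rewrite size_compile.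
  move=> /code_at_cons [k1] /code_at_cons [j2 cd2] hf.
  have [r1 [st1 e1 b1]] := cexp_correct (leqnn 2) hs he ce hf.
  have hs1 := sim_below (leqnn 2) b1 hs.
  have := reach_jz j1 (reach_fits st1); rewrite [r1 5]e1.
  case: eqP IH => [_|_] IH st2.
  + have [t3 [r3 [m3 [ht3 st3 hs3]]]] := IH _ _ _ hs1 cd2 (reach_fits st2).
    exists (size (cexp e 2) + 1 + t3), r3, m3; split=> //; first by nia.
    have -> : p + (size (cexp e 2) + (csize c1 + csize c2).+3) =
      ((p + size (cexp e 2)).+1 + csize c1).+2 + csize c2 by lia.
    exact: reach_trans (reach_trans st1 st2) st3.
  + have [t3 [r3 [m3 [ht3 st3 hs3]]]] := IH _ _ _ hs1 cd1 (reach_fits st2).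
    have st4 := reach_const k1 (reach_fits st3) (leq0n W).
    have := reach_jz j2 (reach_fits st4); rewrite upd_same /= => st5.
    exists (size (cexp e 2) + 1 + t3 + 1 + 1), (upd r3 5 0), m3; split; first by nia.
      have -> : p + (size (cexp e 2) + (csize c1 + csize c2).+3) =
        ((p + size (cexp e 2)).+1 + csize c1 + csize c2).+2 by lia.
      exact: reach_trans (reach_trans (reach_trans (reach_trans st1 st2) st3) st4) st5.
    exact: sim_scratch.
- move=> s e c1 he e0 p r m hs /= /code_at_cat [ce].
  move=> /code_at_cons [j1 _] hf.
  have [r1 [st1 e1 b1]] := cexp_correct (leqnn 2) hs he ce hf.
  have := reach_jz j1 (reach_fits st1); rewrite [r1 5]e1 e0 /= => st2.
  exists (size (cexp e 2) + 1), r1, m; split; first by lia.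
    have -> : p + (size (cexp e 2) + (csize c1).+3) =
      ((p + size (cexp e 2)).+1 + csize c1).+2 by lia.
    exact: reach_trans st1 st2.
  exact: sim_below b1 hs.
- move=> s1 s2 s3 e c1 t u he /eqP ne0 _ IH1 _ IH2 p r m hs hcode hf.
  have := hcode; move=> /= /code_at_cat [ce].
  move=> /code_at_cons [j1] /code_at_cat [cd1]; rewrite size_compile.
  move=> /code_at_cons [k1] /code_at_cons [j2 _].
  have [r1 [st1 e1 b1]] := cexp_correct (leqnn 2) hs he ce hf.
  have hs1 := sim_below (leqnn 2) b1 hs.
  have := reach_jz j1 (reach_fits st1); rewrite [r1 5]e1 (negbTE ne0) => st2.
  have [t3 [r3 [m3 [ht3 st3 hs3]]]] := IH1 _ _ _ hs1 cd1 (reach_fits st2).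
  have st4 := reach_const k1 (reach_fits st3) (leq0n W).
  have := reach_jz j2 (reach_fits st4); rewrite upd_same /= => st5.
  have [||t6 [r6 [m6 [ht6 st6 hs6]]]] := IH2 _ (upd r3 5 0) m3 _ hcode.
  + exact: sim_scratch.
  + exact: (reach_fits st5).
  exists (size (cexp e 2) + 1 + t3 + 1 + 1 + t6), r6, m6; split=> //; first by move: ht6 => /=; nia.
  have st15 := reach_trans (reach_trans (reach_trans (reach_trans st1 st2) st3) st4) st5.
  exact: reach_trans st15 st6.
Qed.

End Machine.

(** * Centres and their representatives *)

Section Centres.

Variables (n c : nat) (E : {set {set 'I_n}}) (C : 'I_c -> {set 'I_n}).
Hypothesis card_edge : forall e, e \in E -> #|e| = 2.

Definition centre (i : 'I_c) (v : 'I_n) : bool :=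
  (v \in C i) && [forall w in C i, (w != v) ==> ([set v; w] \in E)].

(** The edges forced by an assignment: every solution with these centres contains them, and for
    valid centres they already satisfy all communities. *)
Definition stars (phi : 'I_c -> 'I_n) : {set {set 'I_n}} :=
  [set e in E | [exists i, (e \subset C i) && (phi i \in e)]].

Definition twins (u v : 'I_n) : Prop :=
  forall i, (u \in C i) = (v \in C i) /\ centre i u = centre i v.

(* The transposition of u and v maps the edges gained by the replacement
   injectively to edges that are lost. *)
Lemma card_stars_replace (phi : 'I_c -> 'I_n) (u v : 'I_n) :
  (forall i, centre i (phi i)) -> twins u v ->
  #|stars (fun i => if phi i == v then u else phi i)| <= #|stars phi|.
Proof.
move=> cen tw; set phi' := fun i => _.
have [uv|uv] := eqVneq u v.
  apply: subset_leq_card; apply/subsetP => e; rewrite !inE => /andP [-> /=].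
  case/existsP=> i /andP [h1 h2]; apply/existsP; exists i; rewrite h1 /=.
  by move: h2; rewrite /phi'; case: eqP => // ->; rewrite uv.
rewrite -(cardsID (stars phi) (stars phi')) -(cardsID (stars phi') (stars phi)).
rewrite setIC leq_add2l.
have inj : injective (fun e : {set 'I_n} => tperm u v @: e).
  by apply: imset_inj; exact: perm_inj.
rewrite -(card_imset _ inj); apply: subset_leq_card.
apply/subsetP => _ /imsetP [e + ->]; rewrite inE => /andP [eN].
rewrite inE => /andP [eE /existsP [i /andP [eCi phi'e]]].
(* The edge is gained, so community [i] did not pay for it before: its centre must have moved from
   [v] to [u]. *)
have phie : phi i \notin e.
  apply: contra eN => h; rewrite inE eE; apply/existsP; exists i.
  by rewrite eCi.
have phiv : phi i = v.
  by move: phi'e phie; rewrite /phi'; case: eqP => // _ ->.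
have ue : u \in e by move: phi'e; rewrite /phi' phiv eqxx.
have ve : v \notin e by rewrite -phiv.
have [x xu ex] : exists2 x, x != u & e = [set u; x].
  have /cards2P [a [b [ab eab]]] := introT eqP (card_edge eE).
  move: ue; rewrite eab !inE => /orP [/eqP->|/eqP->]; last first.
    by exists a => //; rewrite setUC.
  by exists b; rewrite // eq_sym.
have xv : x != v by apply: contra ve => /eqP<-; rewrite ex !inE eqxx orbT.
have xC : x \in C i by apply: (subsetP eCi); rewrite ex !inE eqxx orbT.
have -> : tperm u v @: e = [set v; x].
  by rewrite ex imsetU !imset_set1 tpermL tpermD // eq_sym.
have vC : v \in C i by have /andP [] := cen i; rewrite phiv.
(* [v] is a valid centre of [C i], so the host contains the image edge. *)
have vxE : [set v; x] \in E.
  by have /andP [_ /forall_inP /(_ _ xC)] := cen i; rewrite phiv xv.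
rewrite inE; apply/andP; split; last first.
  rewrite inE vxE; apply/existsP; exists i; rewrite phiv !inE eqxx andbT.
  by apply/subsetP => z; rewrite !inE => /orP [/eqP->|/eqP->].
(* Were {v, x} still paid for through [C k], the new centre there would be [x], as no new centre
   equals [v]; it was [x] before as well. Since [v] lies in [C k], so does its twin [u], and the
   edge {u, x} was paid for through [C k] all along. *)
rewrite inE negb_and; apply/orP; right; apply/existsP => -[k /andP [kC phi'k]].
have phik : phi k = x.
  move: phi'k; rewrite /phi' !inE; case: (phi k =P v) => [_|/eqP /negbTE -> /eqP] //.
  by rewrite (negbTE uv) eq_sym (negbTE xu).
case/negP: eN; rewrite inE eE; apply/existsP; exists k.
rewrite phik {2}ex !inE eqxx orbT andbT ex.
apply/subsetP => z; rewrite !inE => /orP [/eqP->|/eqP->].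
  by rewrite (tw k).1; apply: (subsetP kC); rewrite !inE eqxx.
by apply: (subsetP kC); rewrite !inE eqxx orbT.
Qed.

Lemma stars_representatives (R : {pred 'I_n}) (phi : 'I_c -> 'I_n) :
  (forall v, exists2 u, u \in R & twins u v) ->
  (forall i, centre i (phi i)) ->
  exists psi : 'I_c -> 'I_n, [/\ forall i, psi i \in R,
    forall i, centre i (psi i) & #|stars psi| <= #|stars phi|].
Proof.
move=> repr cen.
(* The vertices outside [R] are cleared one at a time; no step brings a cleared vertex back, since
   the new centres lie in [R]. *)
suff [psi [h1 h2 h3]] : exists psi : 'I_c -> 'I_n,
    [/\ forall i, psi i \in enum 'I_n -> psi i \in R,
    forall i, centre i (psi i) & #|stars psi| <= #|stars phi|].
  by exists psi; split=> // i; apply: h1; rewrite mem_enum.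
elim: (enum 'I_n) => [|v s [psi [h1 h2 h3]]]; first by exists phi.
have [vR|vR] := boolP (v \in R).
  by exists psi; split=> // i; rewrite inE => /orP [/eqP->|/h1].
have [u uR tw] := repr v.
exists (fun i => if psi i == v then u else psi i); split=> [i|i|].
- by case: eqP => // /eqP /negbTE hv; rewrite inE hv; exact: h1.
- by have := h2 i; case: eqP => // ->; rewrite (tw i).2.
- exact: leq_trans (card_stars_replace h2 tw) h3.
Qed.

End Centres.

Definition community (I : instance) (i : 'I_(num_communities I)) :
  {set 'I_(num_vertices I)} := nth set0 (communities I) i.

(** Centres chosen in a solution cost at most its number of edges, since every edge counted by
    [stars] joins a centre to a member of its community; conversely [stars phi] is itself a
    solution. The integer budget is split into sign and absolute value, the form in which the input
    gives it. *)
Lemma nws_representatives (I : instance) (R : {pred 'I_(num_vertices I)}) :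
  (forall v, exists2 u, u \in R & twins (edges (host I)) (@community I) u v) ->
  unweighted_stars_nws I <->
  (0 <= budget I)%R /\ exists phi : 'I_(num_communities I) -> 'I_(num_vertices I),
    [/\ forall i, phi i \in R,
        forall i, centre (edges (host I)) (@community I) i (phi i)
      & #|stars (edges (host I)) (@community I) phi| <= `|budget I|%N].
Proof.
move=> repr; split.
- move=> [G' [sub card_le star]]; split; first by lia.
  have /fin_all_exists [phi phiP] : forall i : 'I_(num_communities I), exists v,
      v \in community i /\ forall w, w \in community i -> w != v -> adj G' v w.
    move=> i; have [|v hv hw] := star (community i); first exact: mem_nth.
    by exists v.
  have cen i : centre (edges (host I)) (@community I) i (phi i).
    apply/andP; split; first by have [] := phiP i.
    apply/forall_inP => w hw; apply/implyP => hne.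
    by apply: (subsetP sub); have [_] := phiP i; apply.
  have [psi [h1 h2 h3]] := stars_representatives (@edgesP _ _) repr cen.
  exists psi; split=> //; apply: (leq_trans h3).
  have : stars (edges (host I)) (@community I) phi \subset edges G'.
    apply/subsetP => e; rewrite inE => /andP [eE /existsP [i /andP [eC phie]]].
    have /cards2P [a [b [ab eab]]] := introT eqP (edgesP eE).
    have [_ hw] := phiP i.
    have hin z : z \in e -> z \in community i by move=> hz; apply: (subsetP eC).
    move: phie; rewrite {1}eab !inE => /orP [/eqP ea|/eqP eb].
      rewrite eab -ea; apply: hw; last by rewrite ea eq_sym.
      by apply: hin; rewrite eab !inE eqxx orbT.
    rewrite eab setUC -eb; apply: hw; last by rewrite eb.
    by apply: hin; rewrite eab !inE eqxx.
  by move/subset_leq_card/leq_trans; apply; move: card_le; lia.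
- move=> [b0 [phi [phiR cen card_le]]].
  have hE e : e \in stars (edges (host I)) (@community I) phi -> #|e| = 2.
    by rewrite inE => /andP [/edgesP].
  exists (Graph hE); split=> /=.
  + by apply/subsetP => e; rewrite inE => /andP [].
  + by rewrite -(gez0_abs b0) lez_nat.
  + move=> C /(nthP set0) [i hi <-].
    have /andP [hc /forall_inP hw] := cen (Ordinal hi).
    exists (phi (Ordinal hi)) => // w hwC hne.
    rewrite /adj inE (implyP (hw w hwC) hne); apply/existsP; exists (Ordinal hi).
    rewrite !inE eqxx andbT; apply/subsetP => z; rewrite !inE => /orP [] /eqP-> //.
Qed.

(** * Reading an instance off its encoding *)

Section Lists.

Variables (es : seq (nat * nat)) (ls : seq (seq nat)).

Definition inside (i : nat) (e : nat * nat) : bool :=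
  (e.1 \in nth [::] ls i) && (e.2 \in nth [::] ls i).

Definition incident (v : nat) (e : nat * nat) : bool := (v == e.1) || (v == e.2).

Definition deg (i v : nat) : nat :=
  count (fun e => inside i e && incident v e) es.

(* 0 outside the community, 1 inside, 2 at the possible centres. *)
Definition table (i v : nat) : nat :=
  if v \in nth [::] ls i then
    if (deg i v).+1 == size (nth [::] ls i) then 2 else 1
  else 0.

Definition hit (phi : nat -> nat) (e : nat * nat) : bool :=
  has (fun i => inside i e && incident (phi i) e) (iota 0 (size ls)).

Definition cost (phi : nat -> nat) : nat := count (hit phi) es.

End Lists.

Section Bridge.

Variables (I : instance).
Let n := num_vertices I.
Variables (es : seq ('I_n * 'I_n)) (ls : seq (seq 'I_n)).
Hypothesis es_edges :
  perm_eq [seq [set e.1; e.2] | e <- es] (enum (edges (host I))).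
Hypothesis ls_comm :
  all2 (fun l (C : {set 'I_n}) => perm_eq l (enum C)) ls (communities I).

Definition nat_edges : seq (nat * nat) := [seq (val e.1, val e.2) | e <- es].
Definition nat_lists : seq (seq nat) := [seq [seq val v | v <- l] | l <- ls].

Lemma size_lists : size ls = num_communities I.
Proof. by move: ls_comm; rewrite all2E => /andP [/eqP]. Qed.

Lemma size_nat_lists : size nat_lists = num_communities I.
Proof. by rewrite size_map size_lists. Qed.

Lemma list_community (i : 'I_(num_communities I)) :
  perm_eq (nth [::] ls i) (enum (community i)).
Proof.
have hi : i < size ls by rewrite size_lists.
move: ls_comm; rewrite all2E => /andP [/eqP hs /(all_nthP ([::], set0))].
move/(_ i); rewrite size_zip -hs minnn nth_zip //=; exact.
Qed.

Lemma nth_nat_lists (i : 'I_(num_communities I)) :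
  nth [::] nat_lists i = [seq val v | v <- nth [::] ls i].
Proof. by rewrite (nth_map [::]) // size_lists. Qed.

Lemma mem_nat_lists (i : 'I_(num_communities I)) (v : 'I_n) :
  (val v \in nth [::] nat_lists i) = (v \in community i).
Proof.
rewrite nth_nat_lists mem_map; last exact: val_inj.
by rewrite (perm_mem (list_community i)) mem_enum.
Qed.

Lemma size_nth_nat_lists (i : 'I_(num_communities I)) :
  size (nth [::] nat_lists i) = #|community i|.
Proof. by rewrite nth_nat_lists size_map (perm_size (list_community i)) cardE. Qed.

Lemma uniq_nat_lists i : uniq (nth [::] nat_lists i).
Proof.
case: (ltnP i (num_communities I)) => hi.
  rewrite (nth_nat_lists (Ordinal hi)) map_inj_uniq; last exact: val_inj.
  by rewrite (perm_uniq (list_community (Ordinal hi))) enum_uniq.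
by rewrite nth_default // size_nat_lists.
Qed.

Lemma nat_lists_lt i v : v \in nth [::] nat_lists i -> v < n.
Proof.
case: (ltnP i (num_communities I)) => hi.
  by rewrite (nth_nat_lists (Ordinal hi)) => /mapP [w _ ->]; exact: ltn_ord.
by rewrite nth_default // size_nat_lists.
Qed.

Lemma size_edges_list : size es = num_edges I.
Proof. by have := perm_size es_edges; rewrite size_map -cardE. Qed.

Lemma edges_list_mem e : e \in es -> [set e.1; e.2] \in edges (host I).
Proof.
move=> he; rewrite -mem_enum -(perm_mem es_edges).
by apply/mapP; exists e.
Qed.

Lemma edges_list_neq e : e \in es -> e.1 != e.2.
Proof.
move/edges_list_mem/edgesP; rewrite cards2.
by case: eqP.
Qed.

(** Each edge is listed exactly once, so a count over the list is a cardinal. *)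
Lemma count_edges (P : pred {set 'I_n}) :
  count (fun e => P [set e.1; e.2]) es = #|[set e in edges (host I) | P e]|.
Proof.
rewrite -[LHS](count_map (fun e : 'I_n * 'I_n => [set e.1; e.2]) P).
rewrite (seq.permP es_edges) -size_filter cardE.
apply: perm_size; apply: uniq_perm; first exact: filter_uniq (enum_uniq _).
  exact: enum_uniq.
by move=> e; rewrite mem_filter !mem_enum inE andbC.
Qed.

Lemma inside_subset (i : 'I_(num_communities I)) (e : 'I_n * 'I_n) :
  inside nat_lists i (val e.1, val e.2) = ([set e.1; e.2] \subset community i).
Proof. by rewrite /inside /= !mem_nat_lists subUset !sub1set. Qed.

Lemma incident_in (v : 'I_n) (e : 'I_n * 'I_n) :
  incident (val v) (val e.1, val e.2) = (v \in [set e.1; e.2]).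
Proof. by rewrite /incident !inE. Qed.

Lemma cost_stars (phi : nat -> nat) (psi : 'I_(num_communities I) -> 'I_n) :
  (forall i : 'I_(num_communities I), phi i = psi i) ->
  cost nat_edges nat_lists phi = #|stars (edges (host I)) (@community I) psi|.
Proof.
move=> hphi; rewrite /cost /nat_edges count_map -count_edges.
apply: eq_count => e /=; rewrite /hit size_nat_lists.
apply/hasP/existsP => [[i]|[i h]].
  rewrite mem_iota /= add0n => hi h; exists (Ordinal hi).
  rewrite -inside_subset -incident_in.
  by move: h; rewrite (hphi (Ordinal hi)).
exists (val i); first by rewrite mem_iota /= add0n.
by rewrite inside_subset hphi incident_in.
Qed.

(** The listed edges inside the community at [v] correspond to the neighbours [w] of [v] there
    through [[set v; w]], and [v] is a possible centre when these are all the other members. One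
    degree count thus replaces all adjacency tests. *)
Lemma deg_centre (i : 'I_(num_communities I)) (v : 'I_n) : v \in community i ->
  ((deg nat_edges nat_lists i v).+1 == size (nth [::] nat_lists i)) =
  centre (edges (host I)) (@community I) i v.
Proof.
move=> vC; rewrite size_nth_nat_lists (cardsD1 v) vC add1n eqSS.
pose N := [set w in community i :\ v | [set v; w] \in edges (host I)].
have -> : deg nat_edges nat_lists i v = #|N|.
  rewrite /deg /nat_edges count_map.
  rewrite (eq_count (a2 := fun e => ([set e.1; e.2] \subset community i)
    && (v \in [set e.1; e.2]))); last first.
    by move=> e /=; rewrite inside_subset incident_in.
  rewrite (count_edges (fun f => (f \subset community i) && (v \in f))).
  have inj : {in N &, injective (fun w => [set v; w])}.
    move=> w w'; rewrite !inE => /andP [/andP [h _] _] /andP [/andP [h' _] _].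
    move/setP/(_ w); rewrite !inE eqxx orbT (negbTE h) /= => /esym.
    by move/eqP.
  rewrite -(card_in_imset inj); congr #|pred_of_set _|; apply/setP => e.
  rewrite inE; apply/idP/imsetP.
    move=> /andP [eE /andP [eC ve]].
    have /cards2P [a [b [ab eab]]] := introT eqP (edgesP eE).
    have hin z : z \in e -> z \in community i by move=> hz; apply: (subsetP eC).
    have [aC bC] : a \in community i /\ b \in community i.
      by rewrite !hin // eab !inE eqxx ?orbT.
    move: ve eE; rewrite eab !inE => /orP [] /eqP va eE.
      by exists b; [rewrite !inE va eE eq_sym ab bC | rewrite va].
    by exists a; [rewrite !inE va setUC eE ab aC | rewrite va setUC].
  move=> [w]; rewrite !inE => /andP [/andP [h1 h2] h3] ->.
  rewrite h3 !inE eqxx andbT /=; apply/subsetP => z.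
  by rewrite !inE => /orP [] /eqP->.
have sN : N \subset community i :\ v by apply/subsetP => w; rewrite inE => /andP [].
rewrite /centre vC /=; apply/eqP/forall_inP => [h w wC|h].
  apply/implyP => wv.
  have /eqP eN : N == community i :\ v by rewrite eqEcard sN h leqnn.
  have : w \in N by rewrite eN !inE wv.
  by rewrite inE => /andP [].
apply/eqP; rewrite eqn_leq subset_leq_card //=; apply: subset_leq_card.
apply/subsetP => w wD; rewrite inE wD; move: wD; rewrite !inE => /andP [wv wC].
exact: (implyP (h w wC)).
Qed.

Lemma tab_centre (i : 'I_(num_communities I)) (v : 'I_n) :
  (table nat_edges nat_lists i v == 2) = centre (edges (host I)) (@community I) i v.
Proof.
rewrite /table mem_nat_lists; case: (boolP (v \in community i)) => hv.
  by rewrite deg_centre //; case: centre.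
by rewrite /centre (negbTE hv).
Qed.

Lemma tab_member (i : 'I_(num_communities I)) (v : 'I_n) :
  (table nat_edges nat_lists i v != 0) = (v \in community i).
Proof. by rewrite /table mem_nat_lists; case: (v \in _) => //; case: ifP. Qed.

Lemma nws_lists (R : seq nat) :
  {in R, forall v, v < n} ->
  (forall v, v < n -> exists2 u, u \in R & forall i, i < num_communities I ->
     table nat_edges nat_lists i u = table nat_edges nat_lists i v) ->
  unweighted_stars_nws I <->
  (0 <= budget I)%R /\ exists phi : nat -> nat,
    [/\ forall i, i < num_communities I -> phi i \in R,
        forall i, i < num_communities I -> table nat_edges nat_lists i (phi i) = 2
      & cost nat_edges nat_lists phi <= `|budget I|%N].
Proof.
move=> Rn repr.
have tw v : exists2 u, u \in [pred u : 'I_n | val u \in R]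
    & twins (edges (host I)) (@community I) u v.
  have [u uR ht] := repr v (ltn_ord v).
  exists (Ordinal (Rn u uR)) => // i.
  have := ht i (ltn_ord i); rewrite -[u]/(val (Ordinal (Rn u uR))) => e.
  by rewrite -!tab_centre -!tab_member e.
rewrite (nws_representatives tw); split=> -[b0 [phi [h1 h2 h3]]]; split=> //.
- pose psi k := if insub k is Some i then val (phi i) else 0.
  have psiE (i : 'I_(num_communities I)) : psi i = phi i by rewrite /psi valK.
  exists psi; split=> [i hi|i hi|].
  + rewrite -[i]/(val (Ordinal hi)) psiE; exact: h1.
  + by rewrite -[i]/(val (Ordinal hi)) psiE; apply/eqP; rewrite tab_centre.
  + by rewrite (cost_stars psiE).
- have lt i : i < num_communities I -> phi i < n by move=> hi; apply: Rn; apply: h1.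
  pose psi (i : 'I_(num_communities I)) : 'I_n := Ordinal (lt i (ltn_ord i)).
  exists psi; split=> [i|i|].
  + by rewrite inE; apply: h1.
  + by rewrite -tab_centre; apply/eqP; apply: h2.
  + by rewrite -(cost_stars (phi := phi)).
Qed.

End Bridge.

(** * Weakest preconditions with time *)

(** With truncated subtraction the sum of the two differences is zero exactly on equality. The
    branches are swapped because [If] takes its first branch on a nonzero value. *)
Definition IfEq (a b : expr) (p q : cmd) : cmd :=
  If (Plus (Minus a b) (Minus b a)) q p.

Definition For (i N : nat) (body : cmd) : cmd :=
  Seq (Asg i (Cst 0))
      (Whl (Minus (Var N) (Var i)) (Seq body (Asg i (Plus (Var i) (Cst 1))))).

Section WP.

Variables (inp : nat -> nat) (B n c V : nat).

Definition wp (p : cmd) (T : nat) (Q : state -> Prop) (s : state) : Prop :=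
  exists t s', [/\ t <= T, exec inp B n c V p s t s' & Q s'].

Lemma wp_weaken p T T' (Q Q' : state -> Prop) s :
  wp p T Q s -> T <= T' -> (forall s', Q s' -> Q' s') -> wp p T' Q' s.
Proof.
by move=> [t [s' [h1 h2 h3]]] hT hQ; exists t, s'; split; [lia | | exact: hQ].
Qed.

Lemma wp_skip T (Q : state -> Prop) s : Q s -> wp Skip T Q s.
Proof. by exists 0, s; split=> //; exact: ESkip. Qed.

Lemma wp_asg T d e (Q : state -> Prop) s : 0 < T -> safe inp B n c V s e ->
  Q (set_var s d (eval inp s e)) -> wp (Asg d e) T Q s.
Proof. by move=> hT he hQ; exists 1; eexists; split; [| exact: EAsg |]. Qed.

Lemma wp_sto T k a b e (Q : state -> Prop) s : 0 < T ->
  safe inp B n c V s (Arr k a b) -> safe inp B n c V s e ->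
  Q (set_arr s k (eval inp s a) (eval inp s b) (eval inp s e)) ->
  wp (Sto k a b e) T Q s.
Proof. by move=> hT h1 h2 hQ; exists 1; eexists; split; [| exact: ESto |]. Qed.

Lemma wp_seq T T' p q (Q : state -> Prop) s :
  wp p T (wp q T' Q) s -> wp (Seq p q) (T + T') Q s.
Proof.
move=> [t [s1 [h1 h2 [u [s2 [h3 h4 h5]]]]]].
by exists (t + u), s2; split=> //; [lia | exact: ESeq h2 h4].
Qed.

Lemma wp_asg_seq T d e q (Q : state -> Prop) s : safe inp B n c V s e ->
  wp q T Q (set_var s d (eval inp s e)) -> wp (Seq (Asg d e) q) T.+1 Q s.
Proof. by move=> he hq; rewrite -add1n; apply: wp_seq; apply: wp_asg. Qed.

Lemma wp_sto_seq T k a b e q (Q : state -> Prop) s :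
  safe inp B n c V s (Arr k a b) -> safe inp B n c V s e ->
  wp q T Q (set_arr s k (eval inp s a) (eval inp s b) (eval inp s e)) ->
  wp (Seq (Sto k a b e) q) T.+1 Q s.
Proof. by move=> h1 h2 hq; rewrite -add1n; apply: wp_seq; apply: wp_sto. Qed.

Lemma wp_if T e p q (Q : state -> Prop) s : safe inp B n c V s e ->
  (eval inp s e <> 0 -> wp p T Q s) -> (eval inp s e = 0 -> wp q T Q s) ->
  wp (If e p q) T.+1 Q s.
Proof.
move=> he hp hq.
have [t [s' [h1 h2 h3]]] : wp (if eval inp s e == 0 then q else p) T Q s.
  by case: eqP => [/hq|/hp].
by exists t.+1, s'; split=> //; apply: EIf.
Qed.

Lemma wp_ifeq T a b p q (Q : state -> Prop) s :
  safe inp B n c V s a -> safe inp B n c V s b ->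
  eval inp s a <= V -> eval inp s b <= V ->
  (eval inp s a = eval inp s b -> wp p T Q s) ->
  (eval inp s a <> eval inp s b -> wp q T Q s) ->
  wp (IfEq a b p q) T.+1 Q s.
Proof.
move=> ha hb la lb hp hq; apply: wp_if => /=.
- by rewrite ha hb /=; lia.
- by move=> h; apply: hq; lia.
- by move=> h; apply: hp; lia.
Qed.

(** The invariant is indexed by the number of completed rounds and decides the guard, which fails
    precisely at [N]. The extra unit per round pays for the guard, the last one for the final
    test. *)
Lemma wp_whl N T e p (J : nat -> state -> Prop) s :
  (forall k s, J k s -> k <= N ->
     safe inp B n c V s e /\ (eval inp s e == 0) = (k == N)) ->
  (forall k s, k < N -> J k s -> wp p T (J k.+1) s) ->
  J 0 s -> wp (Whl e p) (N * T.+1).+1 (J N) s.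
Proof.
move=> hJ hstep h0.
suff H d : forall k s, k + d = N -> J k s -> wp (Whl e p) (d * T.+1).+1 (J N) s.
  exact: (H N 0).
elim: d => [|d IH] k {h0}s hk h.
  have -> : N = k by lia.
  have [|hs he] := hJ _ _ h; first lia.
  move: he; rewrite -hk addn0 eqxx => /eqP he.
  by exists 1, s; split=> //; exact: EWhl0.
have [|hs he] := hJ _ _ h; first lia.
have /negbTE hkN : k != N by lia.
move: he; rewrite hkN => /negbT/eqP he.
have [|t [s1 [h1 h2 h3]]] := hstep k s _ h; first lia.
have [|u [s2 [h4 h5 h6]]] := IH k.+1 _ _ h3; first lia.
by exists (t + u).+1, s2; split=> //; [lia | exact: EWhl1 h2 h5].
Qed.

(** Two units per round pay for guard and increment, two more for the initialisation and the final
    test. The body has to restore the counter, and [K < V] makes the increment safe. *)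
Lemma wp_for K T i N p (J : nat -> state -> Prop) s : K < V ->
  (forall k s, J k s -> var s i = k /\ var s N = K) ->
  (forall k s, k < K -> J k s ->
     wp p T (fun s' => var s' i = k /\ J k.+1 (set_var s' i k.+1)) s) ->
  J 0 (set_var s i 0) -> wp (For i N p) (K * (T + 2) + 2) (J K) s.
Proof.
move=> hV hJ hstep h0; rewrite addn2; apply: wp_asg_seq => //.
have -> : T + 2 = (T + 1).+1 by lia.
apply: wp_whl => //.
  by move=> k s' /hJ [/= -> ->]; split=> //; lia.
move=> k s' hk h; apply: wp_seq.
apply: wp_weaken (hstep _ _ hk h) (leqnn _) _ => s1 [e1 h1].
by apply: wp_asg => //=; rewrite e1; [lia | rewrite addn1].
Qed.

End WP.

(** * The algorithm *)

Local Notation vn := 0 (only parsing).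
Local Notation vm := 1 (only parsing).
Local Notation vc := 2 (only parsing).
Local Notation vneg := 3 (only parsing).
Local Notation vbud := 4 (only parsing).
Local Notation vp := 5 (only parsing).
Local Notation vsz := 6 (only parsing).
Local Notation vk := 7 (only parsing).
Local Notation vi := 8 (only parsing).
Local Notation ve := 9 (only parsing).
Local Notation vx := 10 (only parsing).
Local Notation vy := 11 (only parsing).
Local Notation vv := 12 (only parsing).
Local Notation vj := 13 (only parsing).
Local Notation vnr := 14 (only parsing).
Local Notation vdup := 15 (only parsing).
Local Notation veq := 16 (only parsing).
Local Notation vu := 17 (only parsing).
Local Notation vcarry := 18 (only parsing).
Local Notation vcost := 19 (only parsing).
Local Notation vvalid := 20 (only parsing).
Local Notation vhit := 21 (only parsing).
Local Notation vres := 22 (only parsing).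

(* Array 0 is [table], array 1 holds in column 0 the digits of the
   current assignment, array 2 holds in row 0 the representatives. *)
Definition tab_at (v : nat) : expr := Arr 0 (Var vi) (Var v).
Definition digit_at : expr := Arr 1 (Var vi) (Cst 0).
Definition centre_at : expr := Arr 2 (Cst 0) digit_at.

Definition incr (v : nat) : cmd := Asg v (Plus (Var v) (Cst 1)).

Definition read_edge : cmd :=
  Seq (Asg vx (Inp (Plus (Cst 5) (Plus (Var ve) (Var ve)))))
      (Asg vy (Inp (Plus (Cst 6) (Plus (Var ve) (Var ve))))).

Definition read_members : cmd :=
  Seq (Asg vsz (Inp (Var vp)))
 (Seq (incr vp)
      (For vk vsz (Seq (Sto 0 (Var vi) (Inp (Var vp)) (Cst 1)) (incr vp)))).

(** The row starts as the indicator of the community. An edge with both ends inside adds one at each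
    end, so entries outside stay zero and a member ends with its inner degree plus one, to be
    compared with the size of the community. *)
Definition count_degrees : cmd :=
  For ve vm (Seq read_edge
    (If (tab_at vx)
       (If (tab_at vy)
         (Seq (Sto 0 (Var vi) (Var vx) (Plus (tab_at vx) (Cst 1)))
              (Sto 0 (Var vi) (Var vy) (Plus (tab_at vy) (Cst 1))))
         Skip)
       Skip)).

Definition mark_centres : cmd :=
  For vv vn (If (tab_at vv)
    (IfEq (tab_at vv) (Var vsz)
      (Sto 0 (Var vi) (Var vv) (Cst 2))
      (Sto 0 (Var vi) (Var vv) (Cst 1)))
    Skip).

Definition build_table : cmd :=
  Seq (Asg vp (Plus (Cst 5) (Plus (Var vm) (Var vm))))
      (For vi vc (Seq read_members (Seq count_degrees mark_centres))).

Definition compare_columns : cmd :=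
  Seq (Asg veq (Cst 1))
      (For vi vc (IfEq (tab_at vu) (tab_at vv) Skip (Asg veq (Cst 0)))).

Definition find_twin : cmd :=
  Seq (Asg vdup (Cst 0))
      (For vj vnr
        (Seq (Asg vu (Arr 2 (Cst 0) (Var vj)))
        (Seq compare_columns
             (If (Var veq) (Asg vdup (Cst 1)) Skip)))).

Definition build_reps : cmd :=
  Seq (Asg vnr (Cst 0))
      (For vv vn (Seq find_twin
        (If (Var vdup) Skip (Seq (Sto 2 (Cst 0) (Var vnr) (Var vv)) (incr vnr))))).

Definition check_centres : cmd :=
  Seq (Asg vvalid (Cst 1))
      (For vi vc (IfEq (Arr 0 (Var vi) centre_at) (Cst 2) Skip (Asg vvalid (Cst 0)))).

Definition check_edge : cmd :=
  Seq (Asg vhit (Cst 0))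
      (For vi vc (If (tab_at vx)
        (If (tab_at vy)
          (Seq (Asg vu centre_at)
               (IfEq (Var vu) (Var vx) (Asg vhit (Cst 1))
                 (IfEq (Var vu) (Var vy) (Asg vhit (Cst 1)) Skip)))
          Skip)
        Skip)).

Definition count_cost : cmd :=
  Seq (Asg vcost (Cst 0))
      (For ve vm (Seq read_edge
        (Seq check_edge (Asg vcost (Plus (Var vcost) (Var vhit)))))).

(** The budget has no bound in terms of [V]; it therefore occurs only in this truncated difference,
    which is zero exactly when the cost is within the budget. *)
Definition record_result : cmd :=
  If (Var vvalid) (If (Minus (Var vcost) (Var vbud)) Skip (Asg vres (Cst 1))) Skip.

(** An odometer with one digit per community in base [vnr], least significant digit first. A carry
    that survives the last digit means that every assignment has been visited; it ends the loop of
    [try_assignments]. *)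
Definition next_assignment : cmd :=
  Seq (Asg vcarry (Cst 1))
      (For vi vc (If (Var vcarry)
        (IfEq (Plus digit_at (Cst 1)) (Var vnr)
          (Sto 1 (Var vi) (Cst 0) (Cst 0))
          (Seq (Sto 1 (Var vi) (Cst 0) (Plus digit_at (Cst 1)))
               (Asg vcarry (Cst 0))))
        Skip)).

Definition try_assignments : cmd :=
  Seq (Asg vres (Cst 0))
 (Seq (Asg vcarry (Cst 0))
      (Whl (Minus (Cst 1) (Var vcarry))
        (Seq check_centres
        (Seq count_cost
        (Seq record_result next_assignment))))).

Definition solve : cmd :=
  Seq build_table (Seq build_reps (Seq try_assignments
    (If (Var vneg) (Asg vres (Cst 0)) Skip))).

(** Without communities only the sign of the budget matters; without vertices a community has no
    centre. In the remaining case row 0 and column 0 of the arrays exist, and there is at least one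
    representative. *)
Definition prog : cmd :=
  If (Var vc) (If (Var vn) solve (Asg vres (Cst 0)))
     (Asg vres (Minus (Cst 1) (Var vneg))).

Lemma all_iotaS (P : pred nat) k : all P (iota 0 k.+1) = all P (iota 0 k) && P k.
Proof. by rewrite -addn1 iotaD all_cat /= andbT. Qed.

Lemma has_iotaS (P : pred nat) k : has P (iota 0 k.+1) = has P (iota 0 k) || P k.
Proof. by rewrite -addn1 iotaD has_cat /= orbF. Qed.

(** * Greedy representatives of the table columns *)

Section Representatives.

Variables (c : nat) (es : seq (nat * nat)) (ls : seq (seq nat)).
Local Notation tab := (table es ls).

Definition same (u v : nat) : bool := all (fun i => tab i u == tab i v) (iota 0 c).

Fixpoint reps (k : nat) : seq nat :=
  if k is k'.+1 then
    if has (same^~ k') (reps k') then reps k' else rcons (reps k') k'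
  else [::].

Lemma reps_lt k u : u \in reps k -> u < k.
Proof.
elim: k => //= k IH; case: ifP => _; first by move/IH; lia.
by rewrite mem_rcons inE => /orP [/eqP->|/IH]; lia.
Qed.

Lemma size_reps k : size (reps k) <= k.
Proof. by elim: k => //= k IH; case: ifP => _; rewrite ?size_rcons; lia. Qed.

Lemma same_refl v : same v v.
Proof. by apply/allP => i _. Qed.

Lemma reps_same k v : v < k -> exists2 u, u \in reps k & same u v.
Proof.
elim: k v => //= k IH v; rewrite ltnS leq_eqVlt => /orP [/eqP->|/IH [u hu hs]].
  case: ifP => [/hasP [u hu hs]|_]; first by exists u.
  by exists k; rewrite ?same_refl // mem_rcons inE eqxx.
by exists u => //; case: ifP => // _; rewrite mem_rcons inE hu orbT.
Qed.

Lemma tab_lt3 i v : tab i v < 3.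
Proof. by rewrite /table; case: ifP => //; case: ifP. Qed.

Definition column (v : nat) : {ffun 'I_c -> 'I_3} := [ffun i : 'I_c => Ordinal (tab_lt3 i v)].

Lemma column_same u v : column u = column v -> same u v.
Proof.
move=> /ffunP h; apply/allP => i; rewrite mem_iota add0n => /= hi.
by have := congr1 val (h (Ordinal hi)); rewrite !ffunE => /= ->.
Qed.

(** Greediness makes the columns of the representatives pairwise different, and a column is a
    function from [c] communities to three values. *)
Lemma size_reps_column k : size (reps k) <= 3 ^ c.
Proof.
have hu : uniq (map column (reps k)).
  elim: k => //= k IH; case: ifP => // /negbT hn.
  rewrite map_rcons rcons_uniq IH andbT; apply/mapP => -[u hu hc].
  by case/negP: hn; apply/hasP; exists u => //; apply: column_same.
have := max_card (mem (map column (reps k))).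
by rewrite (card_uniqP hu) size_map card_ffun !card_ord.
Qed.

End Representatives.

(** * Digits and carries of assignment numbers *)

Definition dig (b k i : nat) : nat := (k %/ b ^ i) %% b.

Lemma dig_lt b k i : 0 < b -> dig b k i < b.
Proof. by move=> hb; rewrite ltn_mod. Qed.

Lemma dvdn_succ_mod b q : 0 < b -> (b %| q.+1) = ((q %% b).+1 == b).
Proof.
move=> hb; have hm : q %% b < b by rewrite ltn_mod.
rewrite {1}(divn_eq q b) -addnS dvdn_addr ?dvdn_mull //.
apply/idP/eqP => [|->] //; move/dvdn_leq => /(_ isT) h; lia.
Qed.

(** Adding one to [k] carries into position [i] exactly when [b ^ i] divides [k.+1]; the carry moves
    on precisely when the digit there is [b - 1]. *)
Lemma dvdn_expS_succ b k i : 0 < b ->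
  (b ^ i.+1 %| k.+1) = (b ^ i %| k.+1) && ((dig b k i).+1 == b).
Proof.
move=> hb; have hd : 0 < b ^ i by rewrite expn_gt0 hb.
case: (boolP (b ^ i %| k.+1)) => [h|h] /=; last first.
  apply: contraNF h; apply: dvdn_trans; exact: dvdn_exp2l.
rewrite -dvdn_succ_mod // expnS -(divnK h) dvdn_pmul2r //.
by rewrite divnS // h.
Qed.

Lemma digS b k i : 0 < b ->
  dig b k.+1 i = if b ^ i %| k.+1 then
                   if (dig b k i).+1 == b then 0 else (dig b k i).+1
                 else dig b k i.
Proof.
move=> hb; have hd : 0 < b ^ i by rewrite expn_gt0 hb.
rewrite {1}/dig divnS //; case: ifP => // h; rewrite add1n modnS.
by rewrite dvdn_succ_mod.
Qed.

Lemma dig0 b i : dig b 0 i = 0.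
Proof. by rewrite /dig div0n mod0n. Qed.

(** Horner's scheme: the digits from position 1 on give a number by induction, to which the lowest
    digit is appended. *)
Lemma dig_surj b c (d : nat -> nat) : 0 < b -> (forall i, i < c -> d i < b) ->
  exists2 k, k < b ^ c & forall i, i < c -> dig b k i = d i.
Proof.
move=> hb; elim: c d => [|c IH] d hd; first by exists 0.
have [|k hk hkd] := IH (fun i => d i.+1); first by move=> i hi; apply: hd.
have h0 : d 0 < b by apply: hd.
have hq : (k * b + d 0) %/ b = k by rewrite divnMDl // divn_small // addn0.
exists (k * b + d 0); first by rewrite expnS; nia.
case=> [_|i hi]; first by rewrite /dig expn0 divn1 modnMDl modn_small.
by rewrite /dig expnS divnMA hq; apply: hkd.
Qed.

(** * Correctness and running time of the procedures *)

Section Verification.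

Local Arguments upd _ _ _ _ /.

Variables (inp : nat -> nat) (B V n m c neg bud : nat).
(** [es] and [ls] are the decoded edges and communities; [off i] is the input position where the
    block of community [i] starts. *)
Variables (es : seq (nat * nat)) (ls : seq (seq nat)) (off : nat -> nat).
Hypothesis n_gt0 : 0 < n.
Hypothesis c_gt0 : 0 < c.
Hypothesis V_large : B + n + m + c + 10 <= V.
Hypothesis size_es : size es = m.
Hypothesis size_ls : size ls = c.
Hypothesis es_lt : forall e, e \in es -> [/\ e.1 < n, e.2 < n & e.1 != e.2].
Hypothesis ls_uniq : forall i, uniq (nth [::] ls i).
Hypothesis ls_lt : forall i v, v \in nth [::] ls i -> v < n.
Hypothesis inp_edge : forall k, k < m ->
  [/\ 6 + (k + k) < B, inp (5 + (k + k)) = (nth (0, 0) es k).1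
    & inp (6 + (k + k)) = (nth (0, 0) es k).2].
Hypothesis off0 : off 0 = 5 + (m + m).
Hypothesis off_le : 5 + (m + m) <= B.
Hypothesis offS : forall i, i < c -> off i.+1 = off i + size (nth [::] ls i) + 1.
Hypothesis inp_size : forall i, i < c ->
  off i.+1 <= B /\ inp (off i) = size (nth [::] ls i).
Hypothesis inp_member : forall i k, i < c -> k < size (nth [::] ls i) ->
  inp (off i + 1 + k) = nth 0 (nth [::] ls i) k.

Local Notation wp := (wp inp B n c V).
Local Notation tab := (table es ls).
Local Notation l i := (nth [::] ls i).
Local Notation same := (same c es ls).
Local Notation reps := (reps c es ls).

Lemma size_l i : size (l i) <= n.
Proof.
rewrite -(size_iota 0 n); apply: uniq_leq_size => // v /ls_lt.
by rewrite mem_iota.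
Qed.

Definition base (s : state) : Prop :=
  [/\ var s vn = n, var s vm = m, var s vc = c, var s vneg = neg & var s vbud = bud].

(** Snapshot while row [i] is under construction: earlier rows are final, later ones still hold the
    initial zeros. Array 1 is carried along as zero because its column 0 will be the first
    assignment. *)
Definition rows (s : state) (i : nat) (f : nat -> nat) : Prop :=
  (forall i' j, arr s 0 i' j = if i' < i then tab i' j else if i' == i then f j else 0)
  /\ forall i' j, arr s 1 i' j = 0.

Lemma rows_ext s i f g : f =1 g -> rows s i f -> rows s i g.
Proof. by move=> fg [h1 h2]; split=> // i' j; rewrite h1 fg. Qed.

Lemma rows_sto s i f j v : rows s i f -> rows (set_arr s 0 i j v) i (upd f j v).
Proof.
move=> [h1 h2]; split=> // i' j' /=; rewrite h1 /upd.
case: (i' =P i) => [->|_] /=; last by [].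
by rewrite ltnn; case: eqP.
Qed.

Lemma rows_at s i f j : rows s i f -> arr s 0 i j = f j.
Proof. by move=> [h _]; rewrite h ltnn eqxx. Qed.

Lemma rows_next s i : rows s i (tab i) -> rows s i.+1 (fun=> 0).
Proof.
move=> [h1 h2]; split=> // i' j; rewrite h1 ltnS.
by case: ltngtP => // [_|->//]; case: eqP.
Qed.

Lemma read_members_wp i s : i < c -> base s -> var s vi = i -> var s vp = off i ->
  rows s i (fun=> 0) ->
  wp read_members (n * 4 + 4) (fun s' => [/\ base s', var s' vi = i,
    var s' vsz = size (l i), var s' vp = off i.+1
    & rows s' i (fun j => j \in l i)]) s.
Proof.
move=> hi hb ei ep hr.
have [hB eB] := inp_size hi; have eO := offS hi; have hl := size_l i.
pose J k s' := [/\ base s' /\ var s' vi = i, var s' vk = k,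
    var s' vsz = size (l i), var s' vp = off i + 1 + k
    & rows s' i (fun j => j \in take k (l i))].
have step k s' : k < size (l i) -> J k s' ->
  wp (Seq (Sto 0 (Var vi) (Inp (Var vp)) (Cst 1)) (incr vp)) 2
     (fun s'' => var s'' vk = k /\ J k.+1 (set_var s'' vk k.+1)) s'.
  move=> hk [[b1 e1] e2 e3 e4 r1].
  have em := inp_member hi hk.
  have hmem : nth 0 (l i) k < n by apply: (@ls_lt i); apply: mem_nth.
  apply: wp_sto_seq; rewrite /= ?e1 ?e4 ?em //; try lia.
  apply: wp_asg; rewrite //= ?e4; first lia.
  split=> //; split=> //=.
  - lia.
  - apply: rows_ext (rows_sto (nth 0 (l i) k) 1 r1) => j.
    rewrite /upd (take_nth 0 hk) mem_rcons inE.
    by case: eqP.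
apply: (@wp_weaken _ _ _ _ _ _ (size (l i) * (2 + 2) + 2).+2).
- apply: wp_asg_seq; rewrite /= ?ep ?eB; first lia.
  apply: wp_asg_seq; rewrite /= ?ep; first lia.
  apply: (wp_for (J := J)) => //; first lia.
  + by move=> k s' [].
  + split=> //=.
    * lia.
    * by rewrite take0; exact: hr.
- lia.
- move=> s' [[b1 e1] e2 e3 e4 r1]; split=> //; first lia.
  by apply: rows_ext r1 => j; rewrite take_size.
Qed.


(** Contents of row [i] after the first [k] edges. The successor keeps membership readable while the
    degrees are being counted. *)
Definition deg_upto (i k j : nat) : nat :=
  if j \in l i then (count (fun e => inside ls i e && incident j e) (take k es)).+1
  else 0.

(** Keeps the counters, and with them their increments, within [V]. *)
Lemma deg_upto_le i k j : k <= m -> deg_upto i k j <= k.+1.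
Proof.
move=> hk; rewrite /deg_upto; case: ifP => // _.
by rewrite ltnS (leq_trans (count_size _ _)) // size_take_min geq_minl.
Qed.

Lemma deg_uptoS i k j : k < m ->
  deg_upto i k.+1 j =
  deg_upto i k j + (inside ls i (nth (0, 0) es k) && incident j (nth (0, 0) es k)).
Proof.
move=> hk; rewrite /deg_upto (take_nth (0, 0)) ?size_es // -cats1 count_cat /= addn0.
case: ifP => [//|hj]; rewrite /inside /incident; move: (nth _ _ _) => -[a b] /=.
by case: eqP => [<-|_]; case: eqP => [<-|_]; rewrite ?hj ?andbF.
Qed.

Lemma count_degrees_wp i s p sz : i < c -> base s -> var s vi = i ->
  var s vp = p -> var s vsz = sz -> rows s i (fun j => j \in l i) ->
  wp count_degrees (m * 8 + 2) (fun s' => [/\ base s', var s' vi = i,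
    var s' vp = p, var s' vsz = sz & rows s' i (deg_upto i m)]) s.
Proof.
move=> hi hb ei ep esz hr.
pose J k s' := [/\ base s' /\ var s' vi = i, var s' ve = k, var s' vp = p,
  var s' vsz = sz & rows s' i (deg_upto i k)].
apply: wp_weaken (wp_for (K := m) (T := 6) (J := J) _ _ _ _) _ _ => //.
- lia.
- by move=> k s' [[[]]].
- move=> k s' hk [[b1 e1] e2 e3 e4 r1].
  have [h1 h2 h3] := inp_edge hk.
  have [x1 x2 x3] : [/\ (nth (0, 0) es k).1 < n, (nth (0, 0) es k).2 < n
    & (nth (0, 0) es k).1 != (nth (0, 0) es k).2].
    by apply: es_lt; apply: mem_nth; rewrite size_es.
  have hS := deg_uptoS i _ hk.
  move: h2 h3 x1 x2 x3 hS; set e := nth _ _ _ => h2 h3 x1 x2 x3 hS.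
  have le1 := deg_upto_le i e.1 (ltnW hk).
  have le2 := deg_upto_le i e.2 (ltnW hk).
  have done_ s'' : ~~ inside ls i e -> base s'' -> var s'' vi = i ->
      var s'' ve = k -> var s'' vp = p -> var s'' vsz = sz ->
      rows s'' i (deg_upto i k) ->
      var s'' ve = k /\ J k.+1 (set_var s'' ve k.+1).
    move=> /negbTE hin; split=> //; split=> //.
    by apply: rows_ext H4 => j; rewrite hS hin addn0.
  apply: (wp_seq (T := 2) (T' := 4)).
  apply: wp_asg_seq; rewrite /= ?e2 ?h2; first lia.
  apply: wp_asg; rewrite //= ?e2 ?h3; first lia.
  apply: wp_if => /=; rewrite ?e1 ?(rows_at _ r1); first lia.
    move=> n1; apply: wp_if => /=; rewrite ?e1 ?(rows_at _ r1); first lia.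
      move=> n2.
      apply: wp_sto_seq; rewrite /= ?e1 ?(rows_at _ r1); try lia.
      (* The second increment reads its entry after the first write; as the endpoints differ, that
         entry is still the old one. *)
      have ne : (e.2 == e.1) = false by rewrite eq_sym (negbTE x3).
      apply: wp_sto; rewrite //= ?e1 ?eqxx ?ne /= ?(rows_at _ r1); try lia.
      split=> //; split=> //=.
      have hin : inside ls i e.
        move: n1 n2; rewrite /deg_upto /inside.
        by case: (e.1 \in _); case: (e.2 \in _).
      apply: rows_ext (rows_sto e.2 (deg_upto i k e.2 + 1)
        (rows_sto e.1 (deg_upto i k e.1 + 1) r1)) => j.
      rewrite hS hin /incident /=.
      case: eqP => [->|_]; first by rewrite orbT.
      by case: eqP => [->|_]; rewrite ?addn0.
    move=> n2; apply: wp_skip; apply: done_ => //.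
    by move: n2; rewrite /deg_upto /inside; case: (e.2 \in _); rewrite ?andbF.
  move=> n1; apply: wp_skip; apply: done_ => //.
  by move: n1; rewrite /deg_upto /inside; case: (e.1 \in _); rewrite ?andbF.
- split=> //=; apply: rows_ext hr => j.
  by rewrite /deg_upto take0 /=; case: ifP.
- by move=> s' [[b1 e1] e2 e3 e4 r1].
Qed.

Lemma deg_upto_all i j : deg_upto i m j = if j \in l i then (deg es ls i j).+1 else 0.
Proof. by rewrite /deg_upto -size_es take_size. Qed.

Lemma tab_deg_upto i j :
  tab i j = if deg_upto i m j == 0 then 0
            else if deg_upto i m j == size (l i) then 2 else 1.
Proof. by rewrite deg_upto_all /table; case: ifP. Qed.

Lemma mark_centres_wp i s p : i < c -> base s -> var s vi = i ->
  var s vp = p -> var s vsz = size (l i) -> rows s i (deg_upto i m) ->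
  wp mark_centres (n * 5 + 2) (fun s' => [/\ base s', var s' vi = i,
    var s' vp = p & rows s' i (tab i)]) s.
Proof.
move=> hi hb ei ep esz hr; have hl := size_l i.
pose J k s' := [/\ base s' /\ var s' vi = i, var s' vv = k, var s' vp = p,
  var s' vsz = size (l i)
  & rows s' i (fun j => if j < k then tab i j else deg_upto i m j)].
apply: wp_weaken (wp_for (K := n) (T := 3) (J := J) _ _ _ _) _ _ => //.
- lia.
- by move=> k s' [[[]]].
- move=> k s' hk [[b1 e1] e2 e3 e4 r1].
  have lek := deg_upto_le i k (leqnn m).
  have ek := rows_at k r1; rewrite ltnn in ek.
  have done_ v : v = tab i k ->
      rows (set_arr s' 0 i k v) i (fun j => if j < k.+1 then tab i j else deg_upto i m j).
    move=> ->; apply: rows_ext (rows_sto k _ r1) => j /=; rewrite ltnS.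
    by case: ltngtP => // ->.
  apply: wp_if => /=; rewrite ?e1 ?e2 ?ek; first lia.
    move=> /eqP/negbTE n1.
    apply: wp_ifeq; rewrite /= ?e1 ?e2 ?e4 ?ek //; try lia.
      move=> eqs; apply: wp_sto; rewrite //= ?e1 ?e2; try lia.
      split=> //; split=> //=; apply: done_.
      by rewrite tab_deg_upto n1 eqs eqxx.
    move=> /eqP/negbTE eqs; apply: wp_sto; rewrite //= ?e1 ?e2; try lia.
    split=> //; split=> //=; apply: done_.
    by rewrite tab_deg_upto n1 eqs.
  move=> n1; apply: wp_skip; split=> //; split=> //=.
  apply: rows_ext r1 => j; rewrite ltnS.
  by case: ltngtP => // ->; rewrite tab_deg_upto n1.
- move=> s' [[b1 e1] e2 e3 e4 r1]; split=> //.
  apply: rows_ext r1 => j; case: ltnP => // hj.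
  (* Columns from [n] on are never visited, but both descriptions of the row vanish there, since
     members are smaller than [n]. *)
  have jl : (j \in l i) = false by apply/negP => /ls_lt; lia.
  by rewrite /table /deg_upto jl.
Qed.

Definition tabulated (s : state) : Prop :=
  forall i j, i < c -> arr s 0 i j = tab i j.

Lemma build_table_wp s : base s -> (forall k i j, arr s k i j = 0) ->
  wp build_table (c * (9 * n + 8 * m + 10) + 3)
     (fun s' => [/\ base s', tabulated s' & forall i j, arr s' 1 i j = 0]) s.
Proof.
move=> hb hz; have [e0 e1 e2 e3 e4] := hb.
pose J k s' := [/\ base s', var s' vi = k, var s' vp = off k & rows s' k (fun=> 0)].
rewrite addn3; apply: wp_asg_seq; rewrite /= ?e1; first lia.
apply: wp_weaken (wp_for (K := c) (J := J)
  (T := (n * 4 + 4) + ((m * 8 + 2) + (n * 5 + 2))) _ _ _ _) _ _.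
- lia.
- by move=> k s' [[_ _ hc _ _] hk _ _].
- move=> k s' hk [b1 i1 p1 r1].
  apply: wp_seq; apply: wp_weaken (read_members_wp hk b1 i1 p1 r1) (leqnn _) _.
  move=> s2 [b2 i2 z2 p2 r2].
  apply: wp_seq; apply: wp_weaken (count_degrees_wp hk b2 i2 p2 z2 r2) (leqnn _) _.
  move=> s3 [b3 i3 p3 z3 r3].
  apply: wp_weaken (mark_centres_wp hk b3 i3 p3 z3 r3) (leqnn _) _.
  move=> s4 [b4 i4 p4 r4]; split=> //; split=> //; exact: rows_next r4.
- split=> //=; last by split=> // i j /=; rewrite hz ?if_same.
- lia.
- move=> s' [b1 _ _ [r1 r2]]; split=> // i j hi.
  by rewrite r1 hi.
Qed.


(** Frame condition of the procedures that only read the arrays: [L] collects the variables they may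
    change. *)
Definition keeps (L : seq nat) (s s' : state) : Prop :=
  (forall x, x \notin L -> var s' x = var s x) /\ arr s' = arr s.

Lemma keeps_set L s s' d v : d \in L -> keeps L s s' -> keeps L s (set_var s' d v).
Proof.
move=> hd [h1 h2]; split=> // x hx /=.
by case: eqP => [ex|_]; [move: hx; rewrite ex hd | exact: h1].
Qed.

Lemma keeps_trans L L' s s' s'' : {subset L' <= L} ->
  keeps L s s' -> keeps L' s' s'' -> keeps L s s''.
Proof.
move=> hL [h1 h2] [h3 h4]; split; last by rewrite h4.
by move=> x hx; rewrite h3 ?h1 //; apply: contra hx; exact: hL.
Qed.

Lemma keeps_base L s s' : all (ltn 4) L -> keeps L s s' -> base s -> base s'.
Proof.
move=> /allP hL [h _] [h0 h1 h2 h3 h4].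
have hx x : x <= 4 -> var s' x = var s x.
  by move=> hx; apply: h; apply/negP => /hL /=; lia.
by split; rewrite hx.
Qed.

(** * Comparing columns and collecting representatives *)

Lemma compare_columns_wp s u v : base s -> tabulated s -> u < n -> v < n ->
  var s vu = u -> var s vv = v ->
  wp compare_columns (4 * c + 3)
     (fun s' => keeps [:: veq; vi] s s' /\ var s' veq = same u v) s.
Proof.
move=> hb ht hu hv eu ev; have [_ _ ec _ _] := hb.
pose J k s' := [/\ keeps [:: veq; vi] s s', var s' vi = k
  & var s' veq = all (fun i => tab i u == tab i v) (iota 0 k)].
rewrite addn3; apply: wp_asg_seq; first by rewrite /=; lia.
apply: wp_weaken (wp_for (K := c) (T := 2) (J := J) _ _ _ _) _ _.
- lia.
- by move=> k s' [[h _] ei _]; split; rewrite // h.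
- move=> k s' hk [[h hr] ei eq1].
  have u1 := tab_lt3 es ls k u; have v1 := tab_lt3 es ls k v.
  have eu' : var s' vu = u by rewrite h.
  have ev' : var s' vv = v by rewrite h.
  apply: wp_ifeq; rewrite /= ?ei ?eu' ?ev' ?hr ?ht //; try lia.
    move=> e; apply: wp_skip; split=> //; split=> //.
      by apply: keeps_set.
    by rewrite all_iotaS e eqxx andbT.
  move=> /eqP/negbTE e; apply: wp_asg => //.
  split=> //; split=> //.
    by do 2! apply: keeps_set => //.
  by rewrite all_iotaS e andbF.
- by split=> //; do 2! apply: keeps_set => //.
- lia.
- by move=> s' [h1 h2 h3].
Qed.

Definition listed (R : seq nat) (s : state) : Prop :=
  var s vnr = size R /\ forall j, j < size R -> arr s 2 0 j = nth 0 R j.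

Lemma find_twin_wp s v R : base s -> tabulated s -> v < n -> var s vv = v ->
  {in R, forall u, u < n} -> size R <= n -> listed R s ->
  wp find_twin (n * (4 * c + 8) + 3)
     (fun s' => keeps [:: vdup; vj; vu; veq; vi] s s' /\
                var s' vdup = has (same^~ v) R) s.
Proof.
move=> hb ht hv ev hR hsz [enr eR].
pose J k s' := [/\ keeps [:: vdup; vj; vu; veq; vi] s s', var s' vj = k
  & var s' vdup = has (same^~ v) (take k R)].
rewrite addn3; apply: wp_asg_seq; first by rewrite /=; lia.
apply: wp_weaken (wp_for (K := size R) (T := (4 * c + 5).+1) (J := J) _ _ _ _) _ _.
- lia.
- by move=> k s' [[h _] ei _]; split; rewrite // h.
- move=> k s' hk [hkp ej edup]; have [h hr] := hkp.
  have uR : nth 0 R k < n by apply: hR; apply: mem_nth.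
  apply: wp_asg_seq; first by rewrite /= ej; lia.
  rewrite /= ej hr eR //; set s1 := set_var _ _ _.
  have hk1 : keeps [:: vdup; vj; vu; veq; vi] s s1 by apply: keeps_set.
  have hb1 : base s1 by apply: keeps_base hk1 hb.
  have ht1 : tabulated s1 by move=> i j hi; rewrite (proj2 hk1) ht.
  have -> : 4 * c + 5 = (4 * c + 3) + 2 by lia.
  apply: wp_seq.
  apply: wp_weaken (compare_columns_wp hb1 ht1 uR hv _ _) (leqnn _) _ => //.
    by rewrite (proj1 hk1).
  move=> s2 [hk2 eq2].
  have hk12 : keeps [:: vdup; vj; vu; veq; vi] s s2.
    by apply: keeps_trans hk1 hk2; apply/allP.
  have ej2 : var s2 vj = k by rewrite (proj1 hk2).
  have ed2 : var s2 vdup = has (same^~ v) (take k R) by rewrite (proj1 hk2).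
  have hS : has (same^~ v) (take k.+1 R) =
      has (same^~ v) (take k R) || same (nth 0 R k) v.
    by rewrite (take_nth 0 hk) has_rcons orbC.
  apply: wp_if => /=; rewrite ?eq2 //.
    move=> e; apply: wp_asg => //=; first lia.
    split=> //; split=> //; first by do 2! apply: keeps_set => //.
    by rewrite hS; move: e; case: same; rewrite ?orbT.
  move=> e; apply: wp_skip; split=> //; split=> //; first by apply: keeps_set.
  by rewrite hS /= ed2; move: e; case: same; rewrite ?orbF.
- split=> //; first by do 2! apply: keeps_set => //.
  by rewrite take0.
- have : size R * (4 * c + 8) <= n * (4 * c + 8) by rewrite leq_mul2r hsz orbT.
  lia.
- by move=> s' [h1 h2]; rewrite take_size.
Qed.

Definition blank (s : state) : Prop := forall i j, arr s 1 i j = 0.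

(** Each vertex is compared with at most [n] representatives along [c] rows: this is the origin of
    the term n^2 c in the final bound. *)
Lemma build_reps_wp s : base s -> tabulated s -> blank s ->
  wp build_reps (n * (n * (4 * c + 8) + 8) + 3)
     (fun s' => [/\ base s', tabulated s', blank s' & listed (reps n) s']) s.
Proof.
move=> hb ht hz; have [en _ _ _ _] := hb.
pose J k s' := [/\ base s' /\ var s' vv = k, tabulated s', blank s'
  & listed (reps k) s'].
rewrite addn3; apply: wp_asg_seq; first by rewrite /=; lia.
apply: wp_weaken (wp_for (K := n) (T := (n * (4 * c + 8) + 3) + 3) (J := J) _ _ _ _) _ _.
- lia.
- by move=> k s' [[[en' _ _ _ _] ek] _ _ _].
- move=> k s' hk [[b1 e1] t1 z1 l1].
  have hR : {in reps k, forall u, u < n} by move=> u /reps_lt; lia.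
  have hszk := size_reps c es ls k.
  have hsz : size (reps k) <= n by rewrite (leq_trans hszk) // ltnW.
  apply: wp_seq; apply: wp_weaken (find_twin_wp b1 t1 hk e1 hR hsz l1) (leqnn _) _.
  move=> s2 [hk2 ed].
  have b2 : base s2 by apply: keeps_base hk2 b1.
  have [e2 en2] : var s2 vv = k /\ var s2 vnr = size (reps k).
    by rewrite !(proj1 hk2) // (proj1 l1).
  have t2 : tabulated s2 by move=> i j hi; rewrite (proj2 hk2) t1.
  have z2 : blank s2 by move=> i j; rewrite (proj2 hk2) z1.
  have l2 j : j < size (reps k) -> arr s2 2 0 j = nth 0 (reps k) j.
    by rewrite (proj2 hk2); apply: (proj2 l1).
  apply: wp_if => /=; rewrite ?ed //.
    move=> e; apply: wp_skip; split=> //; split=> //.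
    by rewrite /listed /=; move: e; case: has.
  move=> e; apply: wp_sto_seq; rewrite /= ?en2 ?e2 //; try lia.
  apply: wp_asg; rewrite //= ?en2; first lia.
  split=> //; split=> //=.
  move: e; case: has => // _; split=> [|j]; rewrite size_rcons /=; first lia.
  rewrite ltnS leq_eqVlt nth_rcons => /orP [/eqP->|hj].
    by rewrite ltnn eqxx.
  by rewrite hj; have -> : (j == size (reps k)) = false by [lia]; apply: l2.
- by split=> //; split.
- lia.
- by move=> s' [[]].
Qed.


Lemma tab_eq0 i v : (tab i v == 0) = (v \notin l i).
Proof. by rewrite /table; case: ifP => // _; case: ifP. Qed.

(** * Evaluating one assignment *)

Section Assignment.

Variables (R : seq nat) (d : nat -> nat).
Hypothesis R_lt : {in R, forall u, u < n}.
Hypothesis size_R : size R <= n.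
Hypothesis d_lt : forall i, i < c -> d i < size R.

Let phi (i : nat) : nat := nth 0 R (d i).

Definition assigned (s : state) : Prop := forall i, i < c -> arr s 1 i 0 = d i.

Lemma phi_lt i : i < c -> phi i < n.
Proof. by move=> hi; apply: R_lt; apply: mem_nth; apply: d_lt. Qed.

Lemma check_centres_wp s : base s -> tabulated s -> listed R s -> assigned s ->
  wp check_centres (4 * c + 3)
     (fun s' => keeps [:: vvalid; vi] s s' /\
        var s' vvalid = all (fun i => tab i (phi i) == 2) (iota 0 c)) s.
Proof.
move=> hb ht [_ hl] ha; have [_ _ ec _ _] := hb.
pose J k s' := [/\ keeps [:: vvalid; vi] s s', var s' vi = k
  & var s' vvalid = all (fun i => tab i (phi i) == 2) (iota 0 k)].
rewrite addn3; apply: wp_asg_seq; first by rewrite /=; lia.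
apply: wp_weaken (wp_for (K := c) (T := 2) (J := J) _ _ _ _) _ _.
- lia.
- by move=> k s' [[h _] ei _]; split; rewrite // h.
- move=> k s' hk [[h hr] ei ev].
  have v1 := tab_lt3 es ls k (phi k); have v2 := phi_lt hk; have v3 := d_lt hk.
  apply: wp_ifeq; rewrite /= ?ei ?hr ?ha ?hl ?ht //; try (rewrite -/(phi k); lia).
    rewrite -/(phi k) => e; apply: wp_skip; split=> //; split=> //.
      by apply: keeps_set.
    by rewrite all_iotaS e eqxx andbT.
  rewrite -/(phi k) => /eqP/negbTE e; apply: wp_asg => //.
  split=> //; split=> //.
    by do 2! apply: keeps_set => //.
  by rewrite all_iotaS e andbF.
- by split=> //; do 2! apply: keeps_set => //.
- lia.
- by move=> s' [h1 h2 h3].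
Qed.

Lemma check_edge_wp s e : base s -> tabulated s -> listed R s -> assigned s ->
  e.1 < n -> e.2 < n -> var s vx = e.1 -> var s vy = e.2 ->
  wp check_edge (8 * c + 3)
     (fun s' => keeps [:: vhit; vi; vu] s s' /\ var s' vhit = hit ls phi e) s.
Proof.
move=> hb ht [_ hl] ha h1 h2 ex ey; have [_ _ ec _ _] := hb.
pose J k s' := [/\ keeps [:: vhit; vi; vu] s s', var s' vi = k
  & var s' vhit = has (fun i => inside ls i e && incident (phi i) e) (iota 0 k)].
rewrite addn3; apply: wp_asg_seq; first by rewrite /=; lia.
apply: wp_weaken (wp_for (K := c) (T := 6) (J := J) _ _ _ _) _ _.
- lia.
- by move=> k s' [[h _] ei _]; split; rewrite // h.
- move=> k s' hk [kp ei ev]; have [h hr] := kp.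
  have v2 := phi_lt hk; have v3 := d_lt hk.
  have ex' : var s' vx = e.1 by rewrite h.
  have ey' : var s' vy = e.2 by rewrite h.
  have miss s'' : ~~ (inside ls k e && incident (phi k) e) ->
      keeps [:: vhit; vi; vu] s s'' -> var s'' vi = k -> var s'' vhit = var s' vhit ->
      var s'' vi = k /\ J k.+1 (set_var s'' vi k.+1).
    move=> /negbTE hn kp' ei' eh; split=> //; split=> //; first exact: keeps_set.
    by rewrite has_iotaS hn orbF /= eh.
  have found s'' : inside ls k e && incident (phi k) e ->
      keeps [:: vhit; vi; vu] s s'' -> var s'' vi = k -> var s'' vhit = 1 ->
      var s'' vi = k /\ J k.+1 (set_var s'' vi k.+1).
    move=> hn kp' ei' eh; split=> //; split=> //; first exact: keeps_set.
    by rewrite has_iotaS hn orbT /= eh.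
  apply: wp_if => /=; rewrite ?ei ?ex' ?hr ?ht //; try lia.
    move/eqP; rewrite tab_eq0 negbK => in1.
    apply: wp_if => /=; rewrite ?ei ?ey' ?hr ?ht //; try lia.
      move/eqP; rewrite tab_eq0 negbK => in2.
      have hin : inside ls k e by rewrite /inside in1.
      apply: wp_asg_seq; rewrite /= ?ei ?hr ?ha ?hl //; first lia.
      rewrite -/(phi k); apply: wp_ifeq; rewrite /= ?ex' //; try lia.
        move=> eq1; apply: wp_asg => //; first by rewrite /=; lia.
        apply: found => //; first by rewrite hin /incident eq1 eqxx.
        by do 2! apply: keeps_set => //.
      move=> /eqP/negbTE ne1; apply: wp_ifeq; rewrite /= ?ey' //; try lia.
        move=> eq2; apply: wp_asg => //; first by rewrite /=; lia.
        apply: found => //; first by rewrite hin /incident eq2 eqxx orbT.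
        by do 2! apply: keeps_set => //.
      move=> /eqP/negbTE ne2; apply: wp_skip; apply: miss => //.
        by rewrite /incident ne1 ne2 andbF.
      exact: keeps_set.
    move/eqP; rewrite tab_eq0 => /negbTE in2; apply: wp_skip; apply: miss => //.
    by rewrite /inside in2 andbF.
  move/eqP; rewrite tab_eq0 => /negbTE in1; apply: wp_skip; apply: miss => //.
  by rewrite /inside in1.
- by split=> //; do 2! apply: keeps_set => //.
- lia.
- by move=> s' [h3 h4 h5]; rewrite /hit size_ls.
Qed.

Lemma count_cost_wp s : base s -> tabulated s -> listed R s -> assigned s ->
  wp count_cost (m * (8 * c + 8) + 3)
     (fun s' => keeps [:: vcost; ve; vx; vy; vhit; vi; vu] s s' /\
        var s' vcost = cost es ls phi) s.
Proof.
move=> hb ht hl ha; have [_ em _ _ _] := hb.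
pose J k s' := [/\ keeps [:: vcost; ve; vx; vy; vhit; vi; vu] s s', var s' ve = k
  & var s' vcost = count (hit ls phi) (take k es)].
rewrite addn3; apply: wp_asg_seq; first by rewrite /=; lia.
apply: wp_weaken (wp_for (K := m) (T := 2 + ((8 * c + 3) + 1)) (J := J) _ _ _ _) _ _.
- lia.
- by move=> k s' [[h _] ei _]; split; rewrite // h.
- move=> k s' hk [kp ek ecost]; have [h hr] := kp.
  have [i1 i2 i3] := inp_edge hk.
  have he : nth (0, 0) es k \in es by apply: mem_nth; rewrite size_es.
  have [x1 x2 _] := es_lt he.
  have hcnt : count (hit ls phi) (take k es) <= k.
    by rewrite (leq_trans (count_size _ _)) // size_take_min geq_minl.
  have hS : count (hit ls phi) (take k.+1 es) =
      count (hit ls phi) (take k es) + hit ls phi (nth (0, 0) es k).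
    by rewrite (take_nth (0, 0)) ?size_es // -cats1 count_cat /= addn0.
  move: i2 i3 he x1 x2 hS; set e := nth _ _ _ => i2 i3 he x1 x2 hS.
  apply: wp_seq.
  apply: wp_asg_seq; rewrite /= ?ek ?i2; first lia.
  apply: wp_asg; rewrite //= ?ek ?i3; first lia.
  set s1 := set_var _ _ _.
  have kp1 : keeps [:: vcost; ve; vx; vy; vhit; vi; vu] s s1.
    by do 2! apply: keeps_set => //.
  have hb1 : base s1 by apply: keeps_base kp1 hb.
  have ht1 : tabulated s1 by move=> i j hi; rewrite (proj2 kp1) ht.
  have hl1 : listed R s1 by case: hl => ? ?; split; rewrite ?(proj1 kp1) ?(proj2 kp1).
  have ha1 : assigned s1 by move=> i hi; rewrite (proj2 kp1) ha.
  apply: wp_seq; apply: wp_weaken (check_edge_wp hb1 ht1 hl1 ha1 x1 x2 _ _) (leqnn _) _ => //.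
  move=> s2 [kp2 eh].
  have kp12 : keeps [:: vcost; ve; vx; vy; vhit; vi; vu] s s2.
    by apply: keeps_trans kp1 kp2; apply/allP.
  have ek2 : var s2 ve = k by rewrite (proj1 kp2).
  have ec2 : var s2 vcost = count (hit ls phi) (take k es) by rewrite (proj1 kp2).
  apply: wp_asg => //=; rewrite ?ec2 ?eh; first by case: hit; lia.
  split=> //; split=> //; first by do 2! apply: keeps_set => //.
- split=> //; first by do 2! apply: keeps_set => //.
  by rewrite take0.
- lia.
- by move=> s' [h1 h2 h3]; split=> //; rewrite /cost h3 -size_es take_size.
Qed.

End Assignment.

(** * Enumerating the assignments *)

Lemma next_assignment_wp R k r s : 0 < size R -> size R <= n ->
  base s -> tabulated s -> listed R s -> assigned (dig (size R) k) s ->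
  var s vres = r ->
  wp next_assignment (6 * c + 3)
     (fun s' => [/\ base s' /\ tabulated s', listed R s',
        assigned (dig (size R) k.+1) s', var s' vres = r
        & var s' vcarry = (size R ^ c %| k.+1)]) s.
Proof.
move=> R0 Rn hb ht hl ha er.
(* After [i] positions the lower digits are those of [k.+1] and the others still those of [k]; the
   pending carry is divisibility of [k.+1] by [size R ^ i]. *)
pose J i s' := [/\ base s' /\ tabulated s', listed R s' /\ var s' vi = i,
  forall i', i' < c -> arr s' 1 i' 0 =
    if i' < i then dig (size R) k.+1 i' else dig (size R) k i',
  var s' vres = r & var s' vcarry = (size R ^ i %| k.+1)].
rewrite addn3; apply: wp_asg_seq; first by rewrite /=; lia.
apply: wp_weaken (wp_for (K := c) (T := 4) (J := J) _ _ _ _) _ _.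
- lia.
- by move=> i s' [[[_ _ ec _ _] _] [_ ei] _ _ _].
- move=> i s' hi [[b1 t1] [l1 ei] a1 r1 c1].
  have ai := a1 i hi; rewrite ltnn in ai.
  have nr1 := proj1 l1; have hd := dig_lt k i R0.
  have hs := digS k i R0; have hx := dvdn_expS_succ k i R0.
  have upto s'' : (forall i', i' != i -> arr s'' 1 i' 0 = arr s' 1 i' 0) ->
      arr s'' 1 i 0 = dig (size R) k.+1 i ->
      forall i', i' < c -> arr s'' 1 i' 0 =
        if i' < i.+1 then dig (size R) k.+1 i' else dig (size R) k i'.
    move=> h1 h2 i' hi'; rewrite ltnS; case: (i' =P i) => [->|/eqP ne].
      by rewrite leqnn.
    by rewrite h1 // a1 // ltn_neqAle ne.
  apply: wp_if => /=; rewrite ?c1 //.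
    move=> hc; have {}hc : size R ^ i %| k.+1 by case: (_ %| _) hc.
    rewrite hc /= in hs hx.
    apply: wp_ifeq; rewrite /= ?ei ?ai ?nr1 //; try lia.
      move=> e1; apply: wp_sto; rewrite //= ?ei; try lia.
      have {}e1 : (dig (size R) k i).+1 == size R by lia.
      split=> //; split=> //.
      + apply: upto => [i' /negbTE ne|] /=; first by rewrite ne.
        by rewrite eqxx hs e1.
      + by rewrite hx e1 /= c1 hc.
    move=> e1; apply: wp_sto_seq; rewrite //= ?ei ?ai; try lia.
    apply: wp_asg => //.
    have {}e1 : ((dig (size R) k i).+1 == size R) = false by lia.
    split=> //; split=> //.
    + apply: upto => [i' /negbTE ne|] /=; first by rewrite ne.
      by rewrite eqxx hs e1 addn1.
    + by rewrite hx e1.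
  move=> hc; have {}hc : (size R ^ i %| k.+1) = false by case: (_ %| _) hc.
  rewrite hc /= in hs hx.
  apply: wp_skip; split=> //; split=> //.
  + by apply: upto => //; rewrite ai hs.
  + by rewrite /= c1 hc hx.
- by split=> //=; rewrite expn0 dvd1n.
- lia.
- move=> s' [[b1 t1] [l1 _] a1 r1 c1]; split=> // i hi.
  by rewrite a1 // hi.
Qed.

Definition assignment (R : seq nat) (k i : nat) : nat := nth 0 R (dig (size R) k i).

Definition good (R : seq nat) (k : nat) : bool :=
  all (fun i => tab i (assignment R k i) == 2) (iota 0 c) &&
  (cost es ls (assignment R k) <= bud).

Lemma try_assignments_wp R s : 0 < size R -> size R <= n ->
  {in R, forall u, u < n} ->
  base s -> tabulated s -> blank s -> listed R s ->
  wp try_assignments (size R ^ c * (10 * c + m * (8 * c + 8) + 13) + 3)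
     (fun s' => base s' /\ var s' vres = has (good R) (iota 0 (size R ^ c))) s.
Proof.
move=> R0 Rn Rlt hb ht hz hl.
pose J k s' := [/\ base s' /\ tabulated s', listed R s',
  assigned (dig (size R) k) s', var s' vres = has (good R) (iota 0 k)
  & var s' vcarry = (k == size R ^ c)].
have N0 : 0 < size R ^ c by rewrite expn_gt0 R0.
rewrite addn3; apply: wp_asg_seq; first by [].
apply: wp_asg_seq; first by [].
apply: wp_weaken (wp_whl (N := size R ^ c) (J := J)
  (T := (4 * c + 3) + ((m * (8 * c + 8) + 3) + (3 + (6 * c + 3)))) _ _ _) _ _.
- move=> k s' [_ _ _ _ hc] _ /=; rewrite hc; split; first by lia.
  by case: (k == _).
- move=> k s' hk [[b1 t1] l1 a1 r1 c1].
  have dlt i : i < c -> dig (size R) k i < size R by move=> _; apply: dig_lt.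
  apply: wp_seq; apply: wp_weaken (check_centres_wp Rlt Rn dlt b1 t1 l1 a1) (leqnn _) _.
  move=> s2 [kp2 ev].
  have b2 : base s2 by apply: keeps_base kp2 b1.
  have t2 : tabulated s2 by move=> i j hi; rewrite (proj2 kp2) t1.
  have l2 : listed R s2 by case: l1 => ? ?; split; rewrite ?(proj1 kp2) ?(proj2 kp2).
  have a2 : assigned (dig (size R) k) s2 by move=> i hi; rewrite (proj2 kp2) a1.
  apply: wp_seq; apply: wp_weaken (count_cost_wp Rlt Rn dlt b2 t2 l2 a2) (leqnn _) _.
  move=> s3 [kp3 ec].
  have b3 : base s3 by apply: keeps_base kp3 b2.
  have t3 : tabulated s3 by move=> i j hi; rewrite (proj2 kp3) t2.
  have l3 : listed R s3 by case: l2 => ? ?; split; rewrite ?(proj1 kp3) ?(proj2 kp3).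
  have a3 : assigned (dig (size R) k) s3 by move=> i hi; rewrite (proj2 kp3) a2.
  have [_ _ _ _ eb] := b3.
  have ev3 : var s3 vvalid =
      all (fun i => tab i (assignment R k i) == 2) (iota 0 c).
    by rewrite (proj1 kp3).
  have er3 : var s3 vres = has (good R) (iota 0 k).
    by rewrite (proj1 kp3) // (proj1 kp2).
  apply: wp_seq.
  pose Q s' := [/\ base s' /\ tabulated s', listed R s',
    assigned (dig (size R) k) s' & var s' vres = has (good R) (iota 0 k.+1)].
  apply: (@wp_weaken _ _ _ _ _ _ 3 3 Q) => //; last first.
    move=> s4 [[b4 t4] l4 a4 r4].
    apply: wp_weaken (next_assignment_wp R0 Rn b4 t4 l4 a4 r4) (leqnn _) _.
    move=> s5 [bt5 l5 a5 r5 c5]; split=> //; rewrite c5; congr nat_of_bool.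
    (* Since [k.+1] is at most [size R ^ c], divisibility is equality: the carry comes out exactly
       after the last assignment. *)
    apply/idP/eqP => [h|->] //.
    by apply/eqP; rewrite eqn_leq hk dvdn_leq.
  apply: wp_if => /=; rewrite ?ev3 //.
    move=> hv; apply: wp_if => /=; rewrite ?ec ?eb //.
      move=> hcost; apply: wp_skip; split=> //; rewrite has_iotaS er3 /good.
      have -> : (cost es ls (assignment R k) <= bud) = false.
        have : cost es ls (assignment R k) - bud <> 0 := hcost; lia.
      by rewrite andbF orbF.
    move=> hcost; apply: wp_asg => //=; first lia.
    split=> //; rewrite has_iotaS /good.
    have -> : cost es ls (assignment R k) <= bud.
      have : cost es ls (assignment R k) - bud = 0 := hcost; lia.
    by case: all hv; rewrite ?orbT.
  move=> hv; apply: wp_skip; split=> //; rewrite has_iotaS er3 /good.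
  by case: all hv; rewrite ?orbF.
- split=> //=; first by move=> i hi; rewrite dig0 /= hz.
  by case: eqP => // h; move: N0; rewrite -h.
- lia.
- by move=> s' [[b1 _] _ _ r1 _].
Qed.

(** The positions in [R] of the chosen centres, read as digits, number the choice. The cost consults
    the assignment only at the [c] communities, so agreement there is enough. *)
Lemma good_exists (R : seq nat) : 0 < size R ->
  has (good R) (iota 0 (size R ^ c)) <->
  exists phi : nat -> nat, [/\ forall i, i < c -> phi i \in R,
    forall i, i < c -> tab i (phi i) = 2 & cost es ls phi <= bud].
Proof.
move=> R0; split.
  case/hasP => k _ /andP [/allP h1 h2]; exists (assignment R k); split=> // i hi.
    by apply: mem_nth; apply: dig_lt.
  by apply/eqP; apply: h1; rewrite mem_iota.
move=> [phi [h1 h2 h3]].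
have [i hi|k hk hkd] := @dig_surj (size R) c (fun i => index (phi i) R) R0.
  by rewrite index_mem; apply: h1.
have E i : i < c -> assignment R k i = phi i.
  by move=> hi; rewrite /assignment hkd // nth_index // h1.
apply/hasP; exists k; first by rewrite mem_iota.
apply/andP; split.
  by apply/allP => i; rewrite mem_iota add0n => /= hi; rewrite E // h2.
suff -> : cost es ls (assignment R k) = cost es ls phi by [].
apply: eq_count => e; apply: eq_in_has => i; rewrite mem_iota add0n size_ls => /= hi.
by rewrite E.
Qed.

Lemma size_reps_gt0 : 0 < size (reps n).
Proof. by have [u] := reps_same c es ls n_gt0; case: (reps n). Qed.

(** Bernoulli's inequality (4/3)^j >= 1 + j/3 at j = k^2, combined with 3k <= k^2 + 3. Passing from
    base 3 to base 4 thus absorbs the factor [c] in the cost of one evaluation. *)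
Lemma mul_exp3_le k : k * 3 ^ (k ^ 2) <= 4 ^ (k ^ 2).
Proof.
have bern j : 3 ^ j * (j + 3) <= 3 * 4 ^ j.
  by elim: j => // j IH; rewrite !expnS; nia.
have h3 : 3 * k <= k ^ 2 + 3 by case: k => [|[|[|k]]] //; rewrite -mulnn; lia.
have := leq_mul (leqnn (3 ^ (k ^ 2))) h3; move: (bern (k ^ 2)).
by set X := 3 ^ _; set Y := 4 ^ _; lia.
Qed.

Lemma solve_wp s : base s -> (forall k i j, arr s k i j = 0) ->
  wp solve (100 * (4 ^ (c ^ 2) * (n + m) + n ^ 2 * c))
     (fun s' => var s' vres =
        (neg == 0) && has (good (reps n)) (iota 0 (size (reps n) ^ c))) s.
Proof.
move=> hb hz.
have hRlt : {in reps n, forall u, u < n} by move=> u /reps_lt.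
have hsz := size_reps c es ls n; have hgt := size_reps_gt0.
set Q := fun s' => _.
apply: (@wp_weaken _ _ _ _ _ _ ((c * (9 * n + 8 * m + 10) + 3) +
  ((n * (n * (4 * c + 8) + 8) + 3) +
  ((size (reps n) ^ c * (10 * c + m * (8 * c + 8) + 13) + 3) + 2))) _ Q) => //.
- apply: wp_seq; apply: wp_weaken (build_table_wp hb hz) (leqnn _) _.
  move=> s1 [b1 t1 z1].
  apply: wp_seq; apply: wp_weaken (build_reps_wp b1 t1 z1) (leqnn _) _.
  move=> s2 [b2 t2 z2 l2].
  apply: wp_seq; apply: wp_weaken (try_assignments_wp hgt hsz hRlt b2 t2 z2 l2) (leqnn _) _.
  move=> s3 [b3 r3]; have [_ _ _ en _] := b3.
  apply: wp_if => // hneg.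
    apply: wp_asg => //; rewrite /Q (_ : (neg == 0) = false) //.
    by apply/eqP; rewrite -en.
  by apply: wp_skip; rewrite /Q r3 -en [var _ vneg]hneg.
(* At most (3^c)^c assignments are tried. Each monomial of the total time is at most X (n + m) + n^2
   c, and the coefficients add up to 97, below the factor 100. The products are isolated to serve as
   atoms for linear arithmetic. *)
- have hN : size (reps n) ^ c <= 3 ^ (c ^ 2).
    by rewrite -mulnn expnM leq_exp2r // size_reps_column.
  have h1 := mul_exp3_le c.
  move: hN h1; set N := _ ^ c; set Y := 3 ^ _; set X := 4 ^ _ => hN h1.
  have Y0 : 0 < Y by rewrite expn_gt0.
  have hcY : c <= c * Y by rewrite leq_pmulr.
  have hYY : Y <= c * Y by rewrite leq_pmull.
  have hcN : c * N <= c * Y by rewrite leq_mul2l hN orbT.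
  have n2 : n <= n ^ 2 by rewrite -mulnn leq_pmulr.
  have n2c : n ^ 2 <= n ^ 2 * c by rewrite leq_pmulr.
  have e2 : n ^ 2 * c = n * (n * c) by rewrite -mulnn mulnA.
  have e3 : n ^ 2 = n * n by rewrite mulnn.
  have p1 : c * (n + m) <= X * (n + m) by rewrite leq_mul2r; apply/orP; right; lia.
  have p2 : c * N * m <= X * m by rewrite leq_mul2r; apply/orP; right; lia.
  have p3 : N * m <= X * m by rewrite leq_mul2r; apply/orP; right; lia.
  have p4 : X <= X * n by rewrite leq_pmulr.
  have p5 : c <= c * n by rewrite leq_pmulr.
  have -> : c * (9 * n + 8 * m + 10) = 9 * (c * n) + 8 * (c * m) + 10 * c by nia.
  have -> : n * (n * (4 * c + 8) + 8) = 4 * (n * (n * c)) + 8 * (n * n) + 8 * n by nia.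
  have -> : N * (10 * c + m * (8 * c + 8) + 13) =
    10 * (c * N) + 8 * (c * N * m) + 8 * (N * m) + 13 * N by nia.
  move: p1; rewrite !mulnDr; lia.
Qed.

End Verification.

(** * The machine program *)

Definition prelude : seq instr :=
  [:: IConst 5 0; IRead 0 5; IRead 3 5; IConst 5 1; IRead 2 5; IConst 5 2; IRead 4 5;
      IConst 5 3; IRead 6 5; IConst 5 4; IRead 8 5;
      IConst 5 1; IAdd 1 0 5; IMul 1 1 4; IAdd 1 1 2; IAdd 1 1 2; IConst 5 5; IAdd 1 1 5].

(** 18 is the length of [prelude]; a zero result jumps over the accepting halt to the rejecting
    one. *)
Definition ram (p : cmd) : program :=
  prelude ++ compile p 18 ++
  [:: IJz vres.*2 (20 + csize p); IHalt true; IHalt false].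

(** An upper bound on the length of the input that is computable from its header in constant time:
    five header words, two words per edge, at most n + 1 words per community. Arrays placed from
    there on never overwrite the input. *)
Definition base_addr (n m c : nat) : nat := n.+1 * c + m + m + 5.

Section Ram.

Variables (p : cmd) (n m c neg bud : nat) (y : seq nat) (W V : nat).
Let x := [:: n, m, c, neg, bud & y].
Let B := base_addr n m c.
Let inp (a : nat) : nat := nth 0 x a.
Hypothesis leVW : V <= W.
Hypothesis W_large : n + 5 + B + 4 * (c * n) <= W.
Hypothesis x_le : forall a, inp a <= W.
Hypothesis size_x : size x <= B.

Lemma code_at_whole (P : program) : code_at P 0 P.
Proof. by []. Qed.

Lemma prelude_correct : exists r,
  reach (ram p) W (init x) 18 (Config 18 r inp) /\
  [/\ [/\ r 0 = n, r 2 = m, r 4 = c, r 6 = neg & r 8 = bud], r 1 = B & r 3 = n].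
Proof.
have hW : n + (n.+1 * c + m + m + 5) + 5 <= W by move: W_large; rewrite /B /base_addr; lia.
have := @code_at_whole (ram p).
rewrite {2}/ram => /code_at_cat [+ _].
move=> /code_at_cons [c1] /code_at_cons [c2] /code_at_cons [c3] /code_at_cons [c4].
move=> /code_at_cons [c5] /code_at_cons [c6] /code_at_cons [c7] /code_at_cons [c8].
move=> /code_at_cons [c9] /code_at_cons [c10] /code_at_cons [c11] /code_at_cons [c12].
move=> /code_at_cons [c13] /code_at_cons [c14] /code_at_cons [c15] /code_at_cons [c16].
move=> /code_at_cons [c17] /code_at_cons [c18] _.
have const q r d v : nth (IHalt false) (ram p) q = IConst d v ->
    fits W (Config q r inp) -> v <= 5 ->
    reach (ram p) W (Config q r inp) 1 (Config q.+1 (upd r d v) inp).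
  by move=> h1 h2 h3; apply: reach_const => //; lia.
have read q r d a v : nth (IHalt false) (ram p) q = IRead d a ->
    fits W (Config q r inp) -> inp (r a) = v ->
    reach (ram p) W (Config q r inp) 1 (Config q.+1 (upd r d v) inp).
  by move=> h1 h2 <-; apply: reach_read.
have add q r d a b v : nth (IHalt false) (ram p) q = IAdd d a b ->
    fits W (Config q r inp) -> r a + r b = v -> v <= W ->
    reach (ram p) W (Config q r inp) 1 (Config q.+1 (upd r d v) inp).
  by move=> h1 h2 <- h3; apply: reach_add.
have mul q r d a b v : nth (IHalt false) (ram p) q = IMul d a b ->
    fits W (Config q r inp) -> r a * r b = v -> v <= W ->
    reach (ram p) W (Config q r inp) 1 (Config q.+1 (upd r d v) inp).
  by move=> h1 h2 <- h3; apply: reach_mul.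
have f0 : fits W (init x) by move=> a; split=> //=; exact: x_le.
have s1 := const _ _ _ _ c1 f0 isT.
have s2 := read _ _ _ _ n c2 (reach_fits s1) erefl.
have s3 := read _ _ _ _ n c3 (reach_fits s2) erefl.
have s4 := const _ _ _ _ c4 (reach_fits s3) isT.
have s5 := read _ _ _ _ m c5 (reach_fits s4) erefl.
have s6 := const _ _ _ _ c6 (reach_fits s5) isT.
have s7 := read _ _ _ _ c c7 (reach_fits s6) erefl.
have s8 := const _ _ _ _ c8 (reach_fits s7) isT.
have s9 := read _ _ _ _ neg c9 (reach_fits s8) erefl.
have s10 := const _ _ _ _ c10 (reach_fits s9) isT.
have s11 := read _ _ _ _ bud c11 (reach_fits s10) erefl.
have s12 := const _ _ _ _ c12 (reach_fits s11) isT.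
have le1 : n.+1 <= W by lia.
have s13 := add _ _ _ _ _ n.+1 c13 (reach_fits s12) (addn1 n) le1.
have le2 : n.+1 * c <= W by lia.
have s14 := mul _ _ _ _ _ (n.+1 * c) c14 (reach_fits s13) erefl le2.
have le3 : n.+1 * c + m <= W by lia.
have s15 := add _ _ _ _ _ (n.+1 * c + m) c15 (reach_fits s14) erefl le3.
have le4 : n.+1 * c + m + m <= W by lia.
have s16 := add _ _ _ _ _ (n.+1 * c + m + m) c16 (reach_fits s15) erefl le4.
have s17 := const _ _ _ _ c17 (reach_fits s16) isT.
have le5 : n.+1 * c + m + m + 5 <= W by lia.
have s18 := add _ _ _ _ _ (n.+1 * c + m + m + 5) c18 (reach_fits s17) erefl le5.
eexists; split.
  apply: (reach_trans s1); apply: (reach_trans s2); apply: (reach_trans s3).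
  apply: (reach_trans s4); apply: (reach_trans s5); apply: (reach_trans s6).
  apply: (reach_trans s7); apply: (reach_trans s8); apply: (reach_trans s9).
  apply: (reach_trans s10); apply: (reach_trans s11); apply: (reach_trans s12).
  apply: (reach_trans s13); apply: (reach_trans s14); apply: (reach_trans s15).
  apply: (reach_trans s16); exact: (reach_trans s17 s18).
by [].
Qed.

(** The 19 additional steps are the 18 of the prelude and the final jump. *)
Lemma ram_correct (T : nat) (Q : nat -> Prop) :
  (forall s, [/\ var s 0 = n, var s 1 = m, var s 2 = c, var s 3 = neg & var s 4 = bud] ->
     (forall k i j, arr s k i j = 0) ->
     wp inp B n c V p T (fun s' => Q (var s' vres)) s) ->
  exists t v, [/\ Q v, t <= csize p * T + 19,
    verdict (ram p) (run (ram p) x t) = Some (v != 0)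
    & forall u, u <= t -> fits W (run (ram p) x u)].
Proof.
move=> hwp; have [r [st1 [regs1 rB rn]]] := prelude_correct.
(* The input occupies only addresses below [B], so the array cells still hold the zeros of the
   initial memory. *)
pose s := State (fun v => r v.*2) (fun _ _ _ => 0).
have hsim : sim inp B n c s r inp.
  split=> // k i j hk hi hj; rewrite /inp nth_default //.
  by apply: leq_trans size_x _; rewrite -addnA leq_addr.
have [t [s' [htT hex hQ]]] := hwp s regs1 (fun _ _ _ => erefl).
have := @code_at_whole (ram p).
rewrite {2}/ram => /code_at_cat [_] /code_at_cat [cd].
rewrite size_compile => /code_at_cons [j1] /code_at_cons [h1] /code_at_cons [h2 _].
have le4 : 4 <= W by lia.
have leB : B + 4 * (c * n) <= W by lia.
have [t2 [r2 [m2 [ht2 st2 sim2]]]] :=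
  compile_correct leVW le4 leB hex hsim cd (reach_fits st1).
have st3 := reach_jz j1 (reach_fits st2).
have [e3 f3] := reach_trans st1 (reach_trans st2 st3).
exists (18 + (t2 + 1)), (var s' vres); split=> //.
- have : csize p * t <= csize p * T by rewrite leq_mul2l htT orbT.
  lia.
- rewrite /run e3 (sim_var sim2 vres) /verdict /fetch [pc _](erefl
    (if var s' vres == 0 then (0 + size prelude + csize p).+2
     else (0 + size prelude + csize p).+1)).
  by case: eqP => _; rewrite ?h1 ?h2.
Qed.

End Ram.

(** * Decoding the input *)

Lemma nth_pairs (es : seq (nat * nat)) k : k < size es ->
  nth 0 (flatten [seq [:: e.1; e.2] | e <- es]) (k + k) = (nth (0, 0) es k).1 /\
  nth 0 (flatten [seq [:: e.1; e.2] | e <- es]) (k + k).+1 = (nth (0, 0) es k).2.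
Proof.
elim: es k => [|e es IH] [|k] //= hk.
by rewrite addnS /=; exact: IH.
Qed.

Lemma size_pairs (es : seq (nat * nat)) :
  size (flatten [seq [:: e.1; e.2] | e <- es]) = size es + size es.
Proof. by elim: es => //= e es ->; rewrite addnS. Qed.

Definition blocks (ls : seq (seq nat)) : seq nat :=
  flatten [seq size l :: l | l <- ls].

Definition block_offset (ls : seq (seq nat)) (i : nat) : nat :=
  sumn [seq (size l).+1 | l <- take i ls].

(** Exposes the size word of a block together with its members, so that both kinds of input reads
    follow from one equation. *)
Lemma drop_blocks ls i : i < size ls ->
  drop (block_offset ls i) (blocks ls) =
  size (nth [::] ls i) :: nth [::] ls i ++ blocks (drop i.+1 ls).
Proof.
elim: ls i => [|l ls IH] [|i] //= hi; first by rewrite drop0.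
by rewrite -(IH i hi) /block_offset /blocks /= addnC -drop_drop drop_size_cat.
Qed.

Lemma block_offsetS ls i : i < size ls ->
  block_offset ls i.+1 = block_offset ls i + size (nth [::] ls i) + 1.
Proof.
move=> hi; rewrite /block_offset (take_nth [::] hi) map_rcons -cats1 sumn_cat /=.
lia.
Qed.

Lemma size_blocks ls : size (blocks ls) = block_offset ls (size ls).
Proof.
rewrite /block_offset take_size; elim: ls => //= l ls <-.
by rewrite size_cat.
Qed.

Lemma block_offset_le (ls : seq (seq nat)) i b : (forall l, l \in ls -> size l <= b) ->
  block_offset ls i <= size ls * b.+1.
Proof.
rewrite /block_offset; elim: ls i => [|l ls IH] [|i] //= h.
have h1 := h l (mem_head _ _).
have := IH i (fun l' hl' => h l' (mem_behead (s := l :: ls) hl')).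
by rewrite mulSn; apply: leq_add.
Qed.

Lemma block_offset_leS ls i : i < size ls -> block_offset ls i.+1 <= size (blocks ls).
Proof.
rewrite size_blocks; elim: ls i => [|l ls IH] //= [|i] hi.
  by rewrite /block_offset /= take0 /= addn0 leq_addr.
by have := IH i hi; rewrite /block_offset /=; lia.
Qed.

(** Turns the encoding into the equations on input cells that the verification assumes: the blocks
    start after 5 header words and 2m endpoints. *)
Lemma solve_decodes (n m c neg bud : nat) (es : seq (nat * nat)) (ls : seq (seq nat)) s :
  let x := [:: n, m, c, neg, bud &
    flatten [seq [:: e.1; e.2] | e <- es] ++ blocks ls] in
  let B := base_addr n m c in
  0 < n -> 0 < c -> size es = m -> size ls = c ->
  (forall e, e \in es -> [/\ e.1 < n, e.2 < n & e.1 != e.2]) ->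
  (forall i, uniq (nth [::] ls i)) ->
  (forall i v, v \in nth [::] ls i -> v < n) ->
  size x <= B ->
  base n m c neg bud s -> (forall k i j, arr s k i j = 0) ->
  wp (fun a => nth 0 x a) B n c (B + n + m + c + 10) solve
     (100 * (4 ^ (c ^ 2) * (n + m) + n ^ 2 * c))
     (fun s' => var s' vres = (neg == 0) &&
        has (good c bud es ls (reps c es ls n))
            (iota 0 (size (reps c es ls n) ^ c))) s.
Proof.
move=> x B n0 c0 hes hls es_lt ls_uniq ls_lt hx hb hz.
have szp := size_pairs es.
have hx' : 5 + (m + m) + size (blocks ls) <= B.
  by move: hx; rewrite /x /= size_cat szp hes; lia.
have nth_block a : nth 0 x (5 + (m + m) + a) = nth 0 (blocks ls) a.
  by rewrite /x -addnA [LHS]/= nth_cat szp hes ltnNge leq_addr add0n addKn.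
apply: (solve_wp (off := fun i => 5 + (m + m) + block_offset ls i)) => //.
- move=> k hk; have [|h1 h2] := @nth_pairs es k; first by rewrite hes.
  split; first lia.
    by rewrite /x /= nth_cat szp hes ifT ?h1 //; lia.
  by rewrite /x /= nth_cat szp hes ifT ?h2 //; lia.
- by rewrite /block_offset take0 /= addn0.
- lia.
- by move=> i hi; rewrite block_offsetS ?hls //; lia.
- move=> i hi; split.
    by have := @block_offset_leS ls i; rewrite hls => /(_ hi); lia.
  by rewrite nth_block -[block_offset _ _]addn0 -nth_drop drop_blocks ?hls.
- move=> i k hi hk.
  have -> : 5 + (m + m) + block_offset ls i + 1 + k =
    5 + (m + m) + (block_offset ls i + k.+1) by lia.
  by rewrite nth_block -nth_drop drop_blocks ?hls //= nth_cat hk.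
Qed.

(** * Degenerate instances and the complete algorithm *)

Lemma nws_no_community (I : instance) : num_communities I = 0 ->
  unweighted_stars_nws I <-> (0 <= budget I)%R.
Proof.
rewrite /num_communities => /size0nil h; split=> [[G' [_ hc _]]|hb]; first by lia.
have h0 e : e \in (set0 : {set {set 'I_(num_vertices I)}}) -> #|e| = 2 by rewrite inE.
by exists (Graph h0); split; rewrite /= ?sub0set ?cards0 ?h.
Qed.

Lemma nws_no_vertex (I : instance) :
  num_vertices I = 0 -> 0 < num_communities I -> ~ unweighted_stars_nws I.
Proof.
move=> n0 c0 [G' [_ _ h]].
have [v _ _] := h _ (mem_nth set0 c0).
by have := ltn_ord v; rewrite {2}n0.
Qed.

(** The upper bound on [size x] keeps the arrays clear of the input; the lower one makes the
    magnitude of [x] dominate the numbers of edges and communities. The maximum with 1 matters when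
    there is no vertex. *)
Lemma prog_correct (I : instance) (x : seq nat) : encodes I x ->
  let n := num_vertices I in let m := num_edges I in let c := num_communities I in
  let neg := nat_of_bool (budget I < 0)%R in let bud := `|budget I|%N in
  exists y, [/\ x = [:: n, m, c, neg, bud & y],
    5 + (m + m) + c <= size x <= base_addr n m c &
    forall s, base n m c neg bud s -> (forall k i j, arr s k i j = 0) ->
    wp (fun a => nth 0 x a) (base_addr n m c) n c (base_addr n m c + n + m + c + 10)
       prog (103 * maxn 1 (4 ^ (c ^ 2) * (n + m) + n ^ 2 * c))
       (fun s' => var s' vres != 0 <-> unweighted_stars_nws I) s].
Proof.
move=> [es [ls [hes hls ->]]] n m c neg bud.
have fe : flatten [seq [:: val e.1; val e.2] | e <- es] =
    flatten [seq [:: e.1; e.2] | e <- nat_edges es].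
  by rewrite /nat_edges -map_comp.
have fl : flatten [seq size l :: [seq val v | v <- l] | l <- ls] =
    blocks (nat_lists ls).
  by rewrite /blocks /nat_lists -map_comp; congr flatten; apply: eq_map => l /=; rewrite size_map.
rewrite fe fl; exists (flatten [seq [:: e.1; e.2] | e <- nat_edges es] ++ blocks (nat_lists ls)).
have sze : size (nat_edges es) = m by rewrite size_map (size_edges_list hes).
have szl : size (nat_lists ls) = c by rewrite (size_nat_lists hls).
have es_lt e : e \in nat_edges es -> [/\ e.1 < n, e.2 < n & e.1 != e.2].
  move=> /mapP [f hf ->] /=; split; try exact: ltn_ord.
  exact: (edges_list_neq hes hf).
have l_uniq := uniq_nat_lists hls; have l_lt := nat_lists_lt hls.
have szn l : l \in nat_lists ls -> size l <= n.
  move=> /(nthP [::]) [i hi <-]; rewrite -(size_iota 0 n).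
  by apply: uniq_leq_size => // v /l_lt; rewrite mem_iota.
have hx : size ([:: n; m; c; neg; bud] ++ flatten [seq [:: e.1; e.2] | e <- nat_edges es]
    ++ blocks (nat_lists ls)) = 5 + (m + m) + size (blocks (nat_lists ls)).
  by rewrite !size_cat size_pairs sze addnA.
have hle : size ([:: n; m; c; neg; bud] ++ flatten [seq [:: e.1; e.2] | e <- nat_edges es]
    ++ blocks (nat_lists ls)) <= base_addr n m c.
  rewrite hx size_blocks /base_addr; have := @block_offset_le _ (size (nat_lists ls)) _ szn.
  by rewrite szl; lia.
split=> //.
  rewrite hle andbT hx leq_add2l size_blocks /block_offset take_size -szl.
  by elim: (nat_lists ls) => //= l l' IH; lia.
move=> s hb hz; have [en em ec eneg ebud] := hb.
set F := 4 ^ _ * _ + _.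
have F1 : 0 < maxn 1 F by rewrite leq_max.
(* Two units are set aside for the tests of [vc] and [vn]. *)
have -> : 103 * maxn 1 F = (103 * maxn 1 F - 2).+2 by lia.
have eb : (neg == 0) = (0 <= budget I)%R by rewrite /neg eqb0 Order.TotalTheory.leNgt.
apply: wp_if => //= hc; last first.
  rewrite ec in hc; apply: wp_asg => //=; first lia.
  rewrite (nws_no_community hc) -eb eneg.
  by have hneg a : 1 - a != 0 <-> a == 0 by [lia]; exact: hneg.
apply: wp_if => //= hn; last first.
  rewrite en in hn; apply: wp_asg => //=; first lia.
  by split=> // h; case: (nws_no_vertex hn _ h); rewrite ec in hc; lia.
have n0 : 0 < n by rewrite en in hn; lia.
have c0 : 0 < c by rewrite ec in hc; lia.
apply: wp_weaken (solve_decodes n0 c0 sze szl es_lt l_uniq l_lt hle hb hz) _ _.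
  by rewrite -/F; have := leq_maxr 1 F; lia.
move=> s' ->.
have hRlt : {in reps c (nat_edges es) (nat_lists ls) n, forall u, u < n}.
  by move=> u; exact: reps_lt.
rewrite (nws_lists hes hls hRlt); last first.
  move=> v hv; have [u hu hs] := reps_same c (nat_edges es) (nat_lists ls) hv.
  exists u => // i hi; apply/eqP; apply: (allP hs).
  by rewrite mem_iota.
rewrite -(good_exists bud (nat_edges es) szl); last first.
  by have [u] := reps_same c (nat_edges es) (nat_lists ls) n0; case: (reps _ _ _ _).
by rewrite -eb -lt0n lt0b; split=> /andP.
Qed.

Theorem theorem24 :
  solvable_in_time encodes unweighted_stars_nws
    (fun I : instance =>
       4 ^ (num_communities I ^ 2) * (num_vertices I + num_edges I)
       + num_vertices I ^ 2 * num_communities I).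
Proof.
(* The largest addresses and words are 5 c n plus linear terms, a constant times the square of the
   magnitude. The magnitude is at least 5, so exponent 4 absorbs the constant. The time factor
   combines the bounds of [prog_correct] and [ram_correct]. *)
exists (ram prog), 4, (csize prog * 103 + 19) => I x henc.
have [y [ex hsz hwp]] := prog_correct henc.
move: ex hsz hwp; set n := num_vertices I; set m := num_edges I.
set c := num_communities I; set neg := nat_of_bool _; set bud := `|_|%N.
set F := 4 ^ _ * _ + _ => ex /andP [hsz1 hsz2] hwp.
set M := magnitude x.
have hmax v : v \in x -> v <= \max_(w <- x) w by move=> hv; exact: leq_bigmax_seq.
(* [size x] accounts for edges and communities, and the maximum over [x] for its first word [n]. *)
have hM : 5 + (m + m) + c + n <= M.
  by rewrite leq_add // hmax // ex mem_head.
have hMx a : nth 0 x a <= M ^ 4.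
  have [ha|ha] := ltnP a (size x); last by rewrite nth_default.
  apply: (@leq_trans M); last by rewrite -[leqLHS]expn1 leq_pexp2l //; lia.
  by rewrite (leq_trans (hmax _ (mem_nth 0 ha))) // leq_addl.
have h1 : 5 * M <= M * M by rewrite leq_mul2r; apply/orP; right; lia.
have h2 : 25 * (M * M) <= M ^ 4.
  by rewrite (expnM M 2 2) -!mulnn leq_mul2r; apply/orP; right; lia.
have h3 : c * n <= M * M by apply: leq_mul; lia.
have eB : base_addr n m c = c * n + c + m + m + 5 by rewrite /base_addr; lia.
rewrite ex in hwp hMx hsz2.
have [||t [v [hv ht hverd hfits]]] := ram_correct (W := M ^ 4)
  (Q := fun v => v != 0 <-> unweighted_stars_nws I) _ _ hMx hsz2 hwp.
- by rewrite eB; lia.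
- by rewrite eB; lia.
exists t, (v != 0); rewrite ex; split=> //.
rewrite (leq_trans ht) // mulnDl mulnA leq_add2l leq_pmulr //.
by rewrite leq_max.
Qed.
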